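(* Let $(R,\mathfrak m)$ be a Gorenstein local ring of dimension $d$, and let $M$ be a finitely generated $R$-module with finite projective dimension. Let $n\geq 1$ be an integer such that $\operatorname{Ext}^n_R(M,M)=0$, and assume that $$\operatorname{depth}_R\operatorname{Ext}^q_R(M,M)\geq d-n-q\quad\text{for all } q=0,\ldots,d-n .$$ Then $\operatorname{pd}_RM\leq n-1$.
   Context: All rings are commutative, unitary and Noetherian. Depth over the local ring $(R,\mathfrak m)$ means $\mathfrak m$-depth, and the depth of the zero module is set to be $+\infty$. $\operatorname{pd}_R$ denotes projective dimension. If $n>d$, the range $q=0,\ldots,d-n$ is empty. *)

(* Defs.v *)
From HB Require Import structures.
From mathcomp Require Import all_boot all_order all_algebra.
From mathcomp Require Import boolp functions.
From mathcomp Require Import ring_quotient generic_quotient.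
From mathcomp.multinomials Require Import freeg.

Set Implicit Arguments.
Unset Strict Implicit.
Unset Printing Implicit Defensive.

Import GRing.Theory.
Local Open Scope ring_scope.
Local Open Scope quotient_scope.

Section SubModule.
Variables (R : pzRingType) (V : lmodType R) (S : submodClosed V).

Record sub_module := SubModule { sub_module_val : V; _ : sub_module_val \in S }.

HB.instance Definition _ := [isSub for sub_module_val].
HB.instance Definition _ := [Choice of sub_module by <:].
HB.instance Definition _ := [SubChoice_isSubLmodule of sub_module by <:].

End SubModule.

Section QuotientModule.
Variables (R : pzRingType) (V : lmodType R) (S : submodClosed V).

(* A copy of S carrying closure under opposites, which [Quotient.quot] needs *)
Definition quot_pred : {pred V} := fun x => x \in S.

Lemma quot_pred_closed : zmod_closed quot_pred.
Proof.
split; first exact: (rpred0 S).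
move=> x y xS yS; rewrite -scaleN1r.
by apply: (rpredD (S := S)) => //; apply: (rpredZ (s := S)).
Qed.
HB.instance Definition _ := GRing.isZmodClosed.Build V quot_pred
  quot_pred_closed.

Definition quot_module := Quotient.quot quot_pred.
HB.instance Definition _ := GRing.Zmodule.on quot_module.

Definition quot_proj (v : V) : quot_module := \pi_(Quotient.quot quot_pred) v.

Lemma quot_proj_surj (x : quot_module) : exists v, x = quot_proj v.
Proof. by exists (repr (x : Quotient.quot quot_pred)); exact/esym/reprK. Qed.

Lemma quot_projP u v : quot_proj u = quot_proj v <-> u - v \in S.
Proof.
rewrite -[_ \in S]/(u - v \in quot_pred) Quotient.idealrBE.
by split=> [/eqP|/eqP].
Qed.

Lemma quot_projD u v : quot_proj (u + v) = quot_proj u + quot_proj v.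
Proof. exact: (Quotient.pi_add quot_pred u v). Qed.

Definition quot_scale (a : R) (x : quot_module) : quot_module :=
  quot_proj (a *: repr (x : Quotient.quot quot_pred)).

Lemma quot_scale_proj a v : quot_scale a (quot_proj v) = quot_proj (a *: v).
Proof.
apply/quot_projP; rewrite -scalerBr; apply: (rpredZ (s := S)).
by apply/quot_projP; exact: reprK.
Qed.

Lemma quot_scaleA a b x : quot_scale a (quot_scale b x) = quot_scale (a * b) x.
Proof.
by have [v ->] := quot_proj_surj x; rewrite !quot_scale_proj scalerA.
Qed.

Lemma quot_scale1 : left_id 1 quot_scale.
Proof.
by move=> x; have [v ->] := quot_proj_surj x; rewrite quot_scale_proj scale1r.
Qed.

Lemma quot_scaleDr : right_distributive quot_scale +%R.
Proof.
move=> a x y; have [u ->] := quot_proj_surj x; have [v ->] := quot_proj_surj y.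
by rewrite -quot_projD !quot_scale_proj scalerDr quot_projD.
Qed.

Lemma quot_scaleDl x : {morph quot_scale^~ x : a b / a + b}.
Proof.
move=> a b; have [v ->] := quot_proj_surj x.
by rewrite !quot_scale_proj scalerDl quot_projD.
Qed.

HB.instance Definition _ := GRing.Zmodule_isLmodule.Build R quot_module
  quot_scaleA quot_scale1 quot_scaleDr quot_scaleDl.

Lemma quot_proj_linear : linear quot_proj.
Proof. by move=> a u v; rewrite quot_projD -quot_scale_proj. Qed.
HB.instance Definition _ := GRing.isLinear.Build R V quot_module _ quot_proj
  quot_proj_linear.

End QuotientModule.

(* ker g / (im f meet ker g) for A --f--> B --g--> C; no hypothesis g o f = 0 *)

Section Homology.
Variables (R : pzRingType) (A B C : lmodType R).
Variables (f : {linear A -> B}) (g : {linear B -> C}).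

Definition ker_pred : {pred B} := fun x => g x == 0.

Lemma ker_pred_closed : submod_closed ker_pred.
Proof.
split; first by rewrite unfold_in linear0.
move=> a u v; rewrite !unfold_in => /eqP gu /eqP gv.
by rewrite linearP gu gv scaler0 addr0.
Qed.
HB.instance Definition _ := GRing.isSubmodClosed.Build R B ker_pred
  ker_pred_closed.

Definition ker_module : lmodType R := sub_module ker_pred.

Definition boundary_pred : {pred ker_module} :=
  fun z => `[< exists x, f x = val z >].

Lemma boundary_pred_closed : submod_closed boundary_pred.
Proof.
split; first by apply/asboolP; exists 0; rewrite linear0.
move=> a u v /asboolP[x fx] /asboolP[y fy]; apply/asboolP.
by exists (a *: x + y); rewrite linearP fx fy.
Qed.
HB.instance Definition _ := GRing.isSubmodClosed.Build R ker_module
  boundary_pred boundary_pred_closed.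

Definition homology : lmodType R := quot_module boundary_pred.

End Homology.

Section HomModules.
Variable R : comPzRingType.

Section HomModule.
Variables U V : lmodType R.

Definition linear_pred : {pred (U -> V)} := fun f => `[< linear f >].

Lemma linear_pred_closed : submod_closed linear_pred.
Proof.
split; first by apply/asboolP => a u v; rewrite /= scaler0 addr0.
move=> a f g /asboolP lf /asboolP lg; apply/asboolP => b u v.
rewrite -[LHS]/(a *: f (b *: u + v) + g (b *: u + v)) lf lg.
rewrite -[RHS]/(b *: (a *: f u + g u) + (a *: f v + g v)).
by rewrite !scalerDr !scalerA [a * b]mulrC addrACA.
Qed.
HB.instance Definition _ := GRing.isSubmodClosed.Build R (U -> V) linear_pred
  linear_pred_closed.

Definition Hom_module : lmodType R := sub_module linear_pred.

End HomModule.

Section Precomposition.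
Variables (P Q N : lmodType R) (d : {linear Q -> P}).

Lemma precomp_linear_pred (f : Hom_module P N) :
  val f \o d \in @linear_pred Q N.
Proof.
apply/asboolP => a u v /=; rewrite linearP.
by have /asboolP -> := valP f.
Qed.

Definition Hom_precomp (f : Hom_module P N) : Hom_module Q N :=
  SubModule (precomp_linear_pred f).

Lemma Hom_precomp_linear : linear Hom_precomp.
Proof. by move=> a f g; apply: val_inj; apply/funext. Qed.
HB.instance Definition _ := GRing.isLinear.Build R
  (Hom_module P N) (Hom_module Q N) _
  Hom_precomp Hom_precomp_linear.

End Precomposition.
End HomModules.

Section Resolutions.
Variable R : pzRingType.
Implicit Types (A B C M : lmodType R).

Definition zero_module M := forall x : M, x = 0.

Definition exact A B C (f : A -> B) (g : B -> C) :=
  forall y, g y = 0 <-> exists x, f x = y.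

Definition projective_module (P : lmodType R) :=
  forall A B (g : {linear A -> B}) (f : {linear P -> B}),
    (forall b, exists a, g a = b) ->
  exists h : {linear P -> A}, forall x, g (h x) = f x.

Definition injective_module (I : lmodType R) :=
  forall A B (g : {linear A -> B}) (f : {linear A -> I}),
    injective g ->
  exists h : {linear B -> I}, forall x, h (g x) = f x.

Record proj_resolution M := ProjResolution {
  pres_obj :> nat -> lmodType R;
  pres_diff : forall i, {linear pres_obj i.+1 -> pres_obj i};
  pres_aug : {linear pres_obj 0 -> M};
  pres_projective : forall i, projective_module (pres_obj i);
  pres_aug_surj : forall x, exists y, pres_aug y = x;
  pres_exact0 : exact (pres_diff 0) pres_aug;
  pres_exact : forall i, exact (pres_diff i.+1) (pres_diff i)
}.

Record inj_resolution M := InjResolution {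
  ires_obj :> nat -> lmodType R;
  ires_diff : forall i, {linear ires_obj i -> ires_obj i.+1};
  ires_aug : {linear M -> ires_obj 0};
  ires_injective : forall i, injective_module (ires_obj i);
  ires_aug_inj : injective ires_aug;
  ires_exact0 : exact ires_aug (ires_diff 0);
  ires_exact : forall i, exact (ires_diff i) (ires_diff i.+1)
}.

(* pd M <= k; the zero module satisfies this for every k *)
Definition proj_dim_le M (k : nat) :=
  exists P : proj_resolution M, forall i, (k < i)%N -> zero_module (P i).

Definition inj_dim_le M (k : nat) :=
  exists I : inj_resolution M, forall i, (k < i)%N -> zero_module (I i).

Definition finite_proj_dim M := exists k, proj_dim_le M k.
Definition finite_inj_dim M := exists k, inj_dim_le M k.

End Resolutions.

Section FreeResolution.
Variable R : nzRingType.

Definition free_module (K : choiceType) : lmodType R := {freeg K / R}.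

Section FreeLift.
Variables (K : choiceType) (M : lmodType R) (f : K -> M).

Definition free_lift (D : free_module K) : M := fglift f D.

Lemma free_lift_linear : linear free_lift.
Proof.
have addB : {morph free_lift : x y / x - y} by exact: lift_is_additive.
have lift0 : free_lift 0 = 0 by rewrite -[X in free_lift X](subrr 0) addB subrr.
have addD : {morph free_lift : x y / x + y}.
  by move=> x y; rewrite -{1}[y]opprK -[- y]sub0r !addB lift0 sub0r opprK.
move=> a u v; rewrite addD; congr (_ + _).
have -> : free_lift u = \sum_(x <- dom u) coeff x u *: f x.
  rewrite -[X in free_lift X]freeg_sumE (big_morph _ addD lift0).
  by apply: eq_bigr => x _; exact: liftU.
rewrite scaler_sumr -[a *: u]/(fgscale a u) /fgscale (big_morph _ addD lift0).
by apply: eq_bigr => x _; rewrite /free_lift !liftU scalerA.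
Qed.
HB.instance Definition _ := GRing.isLinear.Build R (free_module K) M _
  free_lift free_lift_linear.

Lemma free_liftU x : free_lift << x >> = f x.
Proof. by rewrite /free_lift liftU scale1r. Qed.

End FreeLift.

Lemma free_module_ext (K : choiceType) (M : lmodType R)
    (f g : {linear free_module K -> M}) :
  (forall x, f << x >> = g << x >>) -> f =1 g.
Proof.
move=> fg D; rewrite -[D]freeg_sumE !linear_sum; apply: eq_bigr => x _.
have -> : << coeff x D *g x >> = coeff x D *: (<< x >> : free_module K).
  by apply/eqP/freeg_eqP => y; rewrite coeffZ !coeffU mul1r.
by rewrite !linearZ fg.
Qed.

Lemma free_module_projective (K : choiceType) :
  projective_module (free_module K).
Proof.
move=> A B g f g_surj; pose h x := sval (cid (g_surj (f << x >>))).
exists (free_lift h : {linear free_module K -> A}) => D.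
apply: (free_module_ext (f := g \o free_lift h)) => x /=.
by rewrite free_liftU /h; case: cid.
Qed.

Definition free_cover (M : lmodType R) : {linear free_module M -> M} :=
  free_lift (fun x : M => x).

(* syzygy M 0 = M and syzygy M i.+1 is the kernel of the canonical surjection
   from the free module on the set syzygy M i onto syzygy M i *)
Fixpoint syzygy (M : lmodType R) (i : nat) : lmodType R :=
  if i is j.+1 then ker_module (free_cover (syzygy M j)) else M.

Definition free_res_obj (M : lmodType R) (i : nat) : lmodType R :=
  free_module (syzygy M i).

Definition free_res_diff (M : lmodType R) (i : nat) :
    {linear free_res_obj M i.+1 -> free_res_obj M i} :=
  (val : ker_module (free_cover (syzygy M i)) -> free_res_obj M i)
    \o free_cover (syzygy M i.+1).

Lemma free_cover_surj (M : lmodType R) x : exists y, free_cover M y = x.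
Proof. by exists << x >>; rewrite /= free_liftU. Qed.

Lemma free_res_exact0 (M : lmodType R) :
  exact (free_res_diff M 0) (free_cover M).
Proof.
move=> y; split=> [y0|[x <-]]; last exact/eqP/(valP (free_cover _ x)).
have yK : y \in ker_pred (free_cover M) by exact/eqP.
have [x xy] := free_cover_surj (Sub y yK : ker_module (free_cover M)).
by exists x; rewrite /= -[free_lift _ _]/(free_cover _ x) xy.
Qed.

Lemma free_res_exact (M : lmodType R) i :
  exact (free_res_diff M i.+1) (free_res_diff M i).
Proof.
move=> y; rewrite -(@free_res_exact0 (syzygy M i.+1) y).
split=> [y0|y0]; last by rewrite -[LHS]/(val (free_cover _ y)) y0.
by apply: val_inj.
Qed.

Definition free_resolution (M : lmodType R) : proj_resolution M :=
  @ProjResolution R M (free_res_obj M) (free_res_diff M) (free_cover M)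
    (fun i => @free_module_projective (syzygy M i))
    (@free_cover_surj M) (@free_res_exact0 M) (@free_res_exact M).

End FreeResolution.

Section Ext.
Variables (R : comNzRingType).

(* Cohomology of Hom(P, N), with the convention Hom(P_(-1), N) = 0 *)
Definition Ext_of (M : lmodType R) (P : proj_resolution M) (q : nat)
    (N : lmodType R) : lmodType R :=
  if q is r.+1 then
    homology (Hom_precomp (N := N) (pres_diff P r))
             (Hom_precomp (N := N) (pres_diff P r.+1))
  else
    homology (\0 : {linear 'rV[R]_0 -> Hom_module (P 0%N) N})
             (Hom_precomp (N := N) (pres_diff P 0)).

Definition Ext (q : nat) (M N : lmodType R) : lmodType R :=
  Ext_of (free_resolution M) q N.

End Ext.

Section CommutativeAlgebra.
Variable R : comNzRingType.

Definition fin_gen (M : lmodType R) :=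
  exists s : seq M, forall x : M,
    exists c : nat -> R, x = \sum_(i < size s) c i *: s`_i.

Definition noetherian := forall I : submodClosed R^o, fin_gen (sub_module I).

(* [idealr_closed] includes properness *)
Definition maximal_ideal (I : {pred R}) :=
  idealr_closed I /\
  forall J : {pred R}, idealr_closed J -> {subset I <= J} -> {subset J <= I}.

Definition local_ring (m : {pred R}) :=
  maximal_ideal m /\ forall J, maximal_ideal J -> J =i m.

Definition prime_chain (l : nat) (p : nat -> prime_idealr R) :=
  forall i, (i < l)%N ->
    {subset p i <= p i.+1} /\ ~ {subset p i.+1 <= p i}.

Definition krull_dim_eq (d : nat) :=
  (exists p, prime_chain d p) /\
  (forall l p, prime_chain l p -> (l <= d)%N).

Definition gorenstein_local (m : {pred R}) :=
  [/\ noetherian, local_ring m & finite_inj_dim R^o].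

(* the submodule (xs)E *)
Definition ideal_mul (E : lmodType R) (xs : seq R) (v : E) :=
  exists e : nat -> E, v = \sum_(i < size xs) xs`_i *: e i.

(* xs_i is a nonzerodivisor on E / (xs_0, ..., xs_(i-1))E, and (xs)E <> E *)
Definition regular_seq (E : lmodType R) (xs : seq R) :=
  (forall i, (i < size xs)%N -> forall v : E,
     ideal_mul (take i xs) (xs`_i *: v) -> ideal_mul (take i xs) v) /\
  exists v : E, ~ ideal_mul xs v.

(* k <= depth E, where depth E is the supremum of the lengths of the E-regular
   sequences contained in m, and is +oo when E = 0 *)
Definition depth_ge (m : {pred R}) (E : lmodType R) (k : nat) :=
  zero_module E \/
  exists xs : seq R,
    [/\ {subset xs <= m}, regular_seq E xs & (k <= size xs)%N].

End CommutativeAlgebra.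

(* Main.v *)
Require Import Defs.
From HB Require Import structures.
From mathcomp Require Import all_boot all_order all_algebra.
From mathcomp Require Import boolp functions ring_quotient.
From mathcomp Require Import zify.

(** Write [X = RHom (M, M)].  Since [M] has a finite free resolution [F], [X] is
    the perfect complex [Hom (F, F)], with cohomology [Ext^q (M, M)], and it is
    self-dual: the supertrace pairing identifies [Hom (X, R)] with [X].  The
    spectral sequence

      Ext^i (H^q (X), R)  ==>  H^(i - q) (Hom (X, R)) = H^(i - q) (X)

    then bounds the degrees in which [X] has cohomology.  Over a Gorenstein ring
    of dimension [d], [Ext^i (E, R)] vanishes for [i > d - depth E], so the depth
    hypothesis kills all the terms with [i - q > n]: those with [q <= d - n]
    because [depth Ext^q (M, M) >= d - n - q], the others because [i <= d].  Hence
    [Ext^k (M, M) = 0] for [k > n], and for [k = n] by hypothesis.  On the other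
    hand [Ext^p (M, M)] is nonzero for [p = pd M] when [M] is nonzero, by Nakayama's
    lemma, so that [p < n].

    The ingredients are the following.

    - The vanishing of [Ext^(i+1) (E, R)] is expressed by [ext_vanishes], through a
      finite injective resolution of [R]; short exact sequences give the expected
      implications ([ext_vanishes_left], [ext_vanishes_mid], [ext_vanishes_right]).
      Nakayama's lemma for Ext ([ext_vanishes_regular]) gains one degree for each
      regular element.

    - Finite injective dimension is at most [dim R] ([ext_vanishes_dim]): if
      [Ext^i (k, R)] were the last nonzero one, with [i > d], a regular sequence of
      length [i] could be built in [R], and it yields a chain of [i + 1] primes
      ([regular_seq_chain]).  With Nakayama's lemma this bounds Ext by the depth
      ([ext_vanishes_depth]).

    - The hypothesis of finite projective dimension yields a minimal free
      resolution, stored as one graded matrix ([graded_resolution_ex]).  The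
      complex [Hom (F, F)] is then a complex of matrices, its cohomology is
      [Ext (M, M)] ([end_homology_Ext]), and its self-duality is an identity of
      traces ([supertrace_end_diff]).

    - Instead of a spectral sequence, [ext_vanishes_coker] climbs from cokernel to
      cokernel; [end_diff_dual] concludes that cocycles are coboundaries, which
      [top_end_homology] contradicts in degree [pd M]. *)

Set Implicit Arguments.
Unset Strict Implicit.
Unset Printing Implicit Defensive.

Import GRing.Theory.
Local Open Scope ring_scope.

(** * Linear maps and submodules *)

Section LinearMaps.
Variable R : comNzRingType.
Implicit Types A B C U V W X : lmodType R.

Definition mk_linear U V (f : U -> V) (lf : linear f) : {linear U -> V} :=
  HB.pack f (GRing.isLinear.Build R U V *:%R f lf).

Lemma mk_linearE U V (f : U -> V) (lf : linear f) x : mk_linear lf x = f x.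
Proof. by []. Qed.

Definition onto A B (f : A -> B) := forall b, exists a, f a = b.

Definition short_exact A B C (f : {linear A -> B}) (g : {linear B -> C}) :=
  [/\ injective f, onto g & exact f g].

Lemma linear_inj A B (f : {linear A -> B}) :
  (forall x, f x = 0 -> x = 0) -> injective f.
Proof.
move=> f0 x y fxy; apply/eqP; rewrite -subr_eq0; apply/eqP/f0.
by rewrite linearB fxy subrr.
Qed.

Lemma factor_surj B C W (g : {linear B -> C}) (f : {linear B -> W}) :
    onto g -> (forall b, g b = 0 -> f b = 0) ->
  exists h : {linear C -> W}, forall b, h (g b) = f b.
Proof.
move=> gs gf; pose s c := sval (cid (gs c)).
have sK c : g (s c) = c by rewrite /s; case: cid.
have fE b b' : g b = g b' -> f b = f b'.
  move=> e; apply/eqP; rewrite -subr_eq0 -linearB; apply/eqP/gf.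
  by rewrite linearB e subrr.
have l : linear (f \o s).
  by move=> a u v /=; rewrite -linearP; apply: fE; rewrite linearP !sK.
by exists (mk_linear l) => b; apply: fE; rewrite sK.
Qed.

Lemma factor_inj A B X (f : {linear A -> B}) (h : {linear X -> B}) :
    injective f -> (forall x, exists a, f a = h x) ->
  exists k : {linear X -> A}, forall x, f (k x) = h x.
Proof.
move=> fi hf; pose s x := sval (cid (hf x)).
have sK x : f (s x) = h x by rewrite /s; case: cid.
have l : linear s by move=> a u v; apply: fi; rewrite linearP !sK linearP.
by exists (mk_linear l).
Qed.

End LinearMaps.

Section Submodules.
Variable R : comNzRingType.

Record submodule (V : lmodType R) := Submodule {
  carrier :> V -> Prop;
  submodule0 : carrier 0;
  submoduleP : forall a u v, carrier u -> carrier v -> carrier (a *: u + v) }.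

Variable V : lmodType R.
Implicit Types S T : submodule V.

Lemma submoduleZ S a u : S u -> S (a *: u).
Proof.
by move=> Su; rewrite -[_ *: _]addr0; apply: submoduleP => //; exact: submodule0.
Qed.
Lemma submoduleD S u v : S u -> S v -> S (u + v).
Proof. by move=> Su Sv; rewrite -[u]scale1r; apply: submoduleP. Qed.
Lemma submoduleB S u v : S u -> S v -> S (u - v).
Proof. by move=> Su Sv; rewrite -scaleN1r addrC; apply: submoduleP. Qed.
Lemma submodule_sum S (I : Type) (r : seq I) (P : pred I) (F : I -> V) :
  (forall i, P i -> S (F i)) -> S (\sum_(i <- r | P i) F i).
Proof.
by move=> SF; apply: big_ind => //; [exact: submodule0 | exact: submoduleD].
Qed.

Definition submod_pred S : {pred V} := fun v => `[< S v >].

Lemma submod_pred_closed S : submod_closed (submod_pred S).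
Proof.
split; first by apply/asboolP/submodule0.
by move=> a u v /asboolP Su /asboolP Sv; apply/asboolP/submoduleP.
Qed.
HB.instance Definition _ S := GRing.isSubmodClosed.Build R V (submod_pred S)
  (submod_pred_closed S).

Definition submod S : lmodType R := sub_module (submod_pred S).
Definition quotmod S : lmodType R := quot_module (submod_pred S).

Definition submod_val S : {linear submod S -> V} := val : submod S -> V.
Definition quotmod_proj S : {linear V -> quotmod S} := @quot_proj R V (submod_pred S).

Lemma submod_valP S (x : submod S) : S (submod_val S x).
Proof. exact/asboolP/(valP x). Qed.

Lemma submod_val_inj S : injective (submod_val S).
Proof. exact: val_inj. Qed.

Lemma submod_val_ex S v : S v -> exists x, submod_val S x = v.
Proof. by move=> /asboolP Sv; exists (SubModule (Sv : v \in submod_pred S)). Qed.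

Lemma quotmod_proj_surj S : onto (quotmod_proj S).
Proof. by move=> x; have [v ->] := quot_proj_surj x; exists v. Qed.

Lemma quotmod_proj_eq0 S v : quotmod_proj S v = 0 <-> S v.
Proof.
rewrite -[0](linear0 (quotmod_proj S)) quot_projP subr0.
by split=> [/asboolP|/asboolP].
Qed.

Lemma quotmod_short_exact S : short_exact (submod_val S) (quotmod_proj S).
Proof.
split; [exact: submod_val_inj | exact: quotmod_proj_surj |].
move=> v; rewrite quotmod_proj_eq0; split=> [/submod_val_ex //|[x <-]].
exact: submod_valP.
Qed.

Lemma submod_corestr S (X : lmodType R) (f : {linear X -> V}) :
    (forall x, S (f x)) ->
  exists h : {linear X -> submod S}, forall x, submod_val S (h x) = f x.
Proof.
move=> Sf; apply: factor_inj; first exact: submod_val_inj.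
by move=> x; apply: submod_val_ex.
Qed.

End Submodules.

Section MoreSubmodules.
Variable R : comNzRingType.
Implicit Types A B C V W X : lmodType R.

Definition kernel_submod V W (f : {linear V -> W}) : submodule V.
Proof.
exists (fun v => f v = 0); first exact: linear0.
by move=> a u v fu fv; rewrite linearP fu fv scaler0 addr0.
Defined.

Definition image_submod V W (f : {linear V -> W}) : submodule W.
Proof.
exists (fun w => exists v, f v = w); first by exists 0; rewrite linear0.
by move=> a u v [x <-] [y <-]; exists (a *: x + y); rewrite linearP.
Defined.

Definition add_submod V (S T : submodule V) : submodule V.
Proof.
exists (fun v => exists s t, [/\ S s, T t & v = s + t]).
  by exists 0, 0; rewrite addr0; split=> //; apply: submodule0.
move=> a u v [s [t [Ss Tt ->]]] [s' [t' [Ss' Tt' ->]]].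
exists (a *: s + s'), (a *: t + t').
by split; [exact: submoduleP | exact: submoduleP | rewrite scalerDr addrACA].
Defined.

Definition preimage_submod V W (f : {linear V -> W}) (S : submodule W) : submodule V.
Proof.
exists (fun v => S (f v)); first by rewrite linear0; apply: submodule0.
by move=> a u v Su Sv; rewrite linearP; apply: submoduleP.
Defined.

Lemma kernel_short_exact V W (f : {linear V -> W}) :
  onto f -> short_exact (submod_val (kernel_submod f)) f.
Proof.
move=> fs; split; [exact: submod_val_inj | exact: fs |].
by move=> v; split=> [/(submod_val_ex (S := kernel_submod f)) |[x <-]] //; exact: (submod_valP x).
Qed.

Lemma projective_lift A B C X (f : {linear A -> B}) (g : {linear B -> C})
    (h : {linear X -> B}) :
    projective_module X -> exact f g -> (forall x, g (h x) = 0) ->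
  exists k : {linear X -> A}, forall x, f (k x) = h x.
Proof.
move=> Xp ex gh; pose K := kernel_submod g.
have [|h' h'E] := @submod_corestr _ _ K _ h; first exact: gh.
have [|f' f'E] := @submod_corestr _ _ K _ f; first by move=> a; apply/ex; exists a.
have [z|k kE] := Xp _ _ f' h'; last by exists k => x; rewrite -f'E kE h'E.
have /ex[a aE] := submod_valP z; exists a.
by apply: submod_val_inj; rewrite f'E.
Qed.

End MoreSubmodules.

(** * Finite generation and chain conditions *)

Section FinGen.
Variable R : comNzRingType.
Implicit Types V W : lmodType R.

Definition spans V (s : seq V) : submodule V.
Proof.
exists (fun v => exists c : nat -> R, v = \sum_(i < size s) c i *: s`_i).
  by exists (fun=> 0); rewrite big1 // => i _; rewrite scale0r.
move=> a u v [c ->] [c' ->]; exists (fun i => a * c i + c' i).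
rewrite scaler_sumr -big_split /=; apply: eq_bigr => i _.
by rewrite scalerA -scalerDl.
Defined.

Lemma spans_nil V (v : V) : spans [::] v <-> v = 0.
Proof.
split=> [[c ->]|->]; last exact: submodule0.
by rewrite big_ord0.
Qed.

Lemma spans_cons V (x : V) s v : spans (x :: s) v <-> exists a, spans s (v - a *: x).
Proof.
split=> [[c ->]|[a [c /eqP]]].
  exists (c 0%N), (fun i => c i.+1).
  by rewrite big_ord_recl /= addrC addKr.
rewrite subr_eq => /eqP ->; exists (fun i => if i is j.+1 then c j else a).
by rewrite big_ord_recl /= addrC.
Qed.

Lemma mem_spans V (s : seq V) x : x \in s -> spans s x.
Proof.
elim: s => // y s IH; rewrite inE spans_cons => /orP[/eqP ->|/IH sx].
  by exists 1; rewrite scale1r subrr; apply: submodule0.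
by exists 0; rewrite scale0r subr0.
Qed.

Lemma spans_sub V (S : submodule V) s v :
  (forall x, x \in s -> S x) -> spans s v -> S v.
Proof.
move=> Ss [c ->]; apply: submodule_sum => i _; apply: submoduleZ.
by apply: Ss; apply: mem_nth.
Qed.

Definition fg_submod V (S : submodule V) :=
  exists2 s : seq V, (forall x, x \in s -> S x) & forall v, S v -> spans s v.



Lemma spans_linear V W (f : {linear V -> W}) s v :
  spans s v -> spans (map f s) (f v).
Proof.
case=> c ->; exists c; rewrite size_map linear_sum; apply: eq_bigr => i _.
by rewrite linearZ (nth_map 0).
Qed.

Lemma fin_gen_surj V W (f : {linear V -> W}) :
  onto f -> fin_gen V -> fin_gen W.
Proof.
move=> fs [s Vs]; exists (map f s) => w; have [v <-] := fs w.
by apply: spans_linear; apply: Vs.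
Qed.

Lemma fg_submod_fin_gen V (S : submodule V) : fg_submod S <-> fin_gen (submod S).
Proof.
split=> [[s Ss sS]|[s sS]]; last first.
  exists (map (submod_val S) s) => [x /mapP[y _ ->]|v]; first exact: submod_valP.
  by move=> /submod_val_ex[x <-]; apply: spans_linear; apply: sS.
have [t tE] : exists t : seq (submod S), map (submod_val S) t = s.
  elim: s Ss {sS} => [|x s IH] Ss; first by exists [::].
  have [|t <-] := IH; first by move=> y ys; apply: Ss; rewrite inE ys orbT.
  have [y <-] := submod_val_ex (Ss x (mem_head x s)).
  by exists (y :: t).
exists t => x; have [c] := sS _ (submod_valP x).
rewrite -tE size_map => xE; exists c; apply: submod_val_inj.
rewrite xE linear_sum; apply: eq_bigr => i _.
by rewrite linearZ (nth_map 0).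
Qed.

Definition delta_basis n : seq 'rV[R]_n := [seq delta_mx 0 i | i <- enum 'I_n].

Lemma delta_basisP n v : spans (delta_basis n) v.
Proof.
rewrite (row_sum_delta v); apply: submodule_sum => i _; apply: submoduleZ.
by apply: mem_spans; apply/mapP; exists i => //; rewrite mem_enum.
Qed.

Lemma fin_gen_rV n : fin_gen 'rV[R]_n.
Proof. by exists (delta_basis n); exact: delta_basisP. Qed.

Lemma spansP V (s : seq V) v :
  spans s v <-> exists u : 'rV[R]_(size s), v = \sum_i u 0 i *: s`_i.
Proof.
split=> [[c ->]|[u ->]].
  by exists (\row_i c i); apply: eq_bigr => i _; rewrite mxE.
exists (fun i => if insub i is Some j then u 0 j else 0).
by apply: eq_bigr => i _; rewrite valK.
Qed.

Definition comb V (s : seq V) (u : 'rV[R]_(size s)) : V := \sum_i u 0 i *: s`_i.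
Lemma comb_linear V (s : seq V) : linear (@comb V s).
Proof.
move=> a u v; rewrite /comb scaler_sumr -big_split; apply: eq_bigr => i _ /=.
by rewrite !mxE scalerDl scalerA.
Qed.
HB.instance Definition _ V (s : seq V) :=
  GRing.isLinear.Build R 'rV[R]_(size s) V *:%R (@comb V s) (@comb_linear V s).

Lemma comb_surj V (s : seq V) : (forall v, spans s v) -> onto (@comb V s).
Proof. by move=> sV v; have /spansP[u ->] := sV v; exists u. Qed.

Section Noetherian.
Hypothesis R_noeth : noetherian R.

Lemma ideal_fg (I : submodule R^o) : fg_submod I.
Proof. exact/fg_submod_fin_gen/R_noeth. Qed.

(** By induction on the number of generators: the coefficients of the last
    generator along [S] form an ideal, and the combinations of elements of [S]
    with prescribed coefficient reduce to the part of [S] inside the span of the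
    other generators. *)
Lemma noeth_submod V (s : seq V) (S : submodule V) :
  (forall v, S v -> spans s v) -> fg_submod S.
Proof.
elim: s S => [|x s IH] S Ss.
  by exists [::] => // v /Ss.
have @I : submodule R^o.
  exists (fun c : R^o => exists2 v, S v & spans s (v - c *: x)).
    by exists 0; [exact: submodule0 | rewrite scale0r subr0; exact: submodule0].
  move=> a b c [u Su ub] [v Sv vc]; exists (a *: u + v); first exact: submoduleP.
  have -> : a *: u + v - (a *: b + c) *: x = a *: (u - b *: x) + (v - c *: x).
    by rewrite scalerBr scalerDl scalerA opprD addrACA.
  exact: submoduleP.
have [r rI Ir] := ideal_fg I.
have @S0 : submodule V.
  exists (fun v => S v /\ spans s v); first by split; exact: submodule0.
  by move=> a u v [? ?] [? ?]; split; exact: submoduleP.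
have [|s0 s0S S0s] := IH S0; first by move=> v [].
have [t tS tr] : exists2 t : seq V, (forall y, y \in t -> S y) &
    forall c, spans r c -> exists2 v, spans t v & spans s (v - c *: x).
  elim: r rI {Ir} => [|c r IHr] rI.
    exists [::] => // c /spans_nil ->.
    by exists 0; [exact: submodule0 | rewrite scale0r subr0; exact: submodule0].
  have [|t tS tr] := IHr; first by move=> y yr; apply: rI; rewrite inE yr orbT.
  have [v Sv vc] := rI c (mem_head _ _).
  exists (v :: t) => [y|b /spans_cons[a /tr[w tw wb]]].
    by rewrite inE => /orP[/eqP -> //|/tS].
  exists (a *: v + w).
    by apply/spans_cons; exists a; rewrite addrC addKr.
  have -> : a *: v + w - b *: x = a *: (v - c *: x) + (w - (b - a *: c) *: x).
    by rewrite scalerBr scalerA scalerBl opprB addrACA [_ + (_ - _)]addrA addNr sub0r.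
  exact: submoduleP.
exists (t ++ s0) => [y|v Sv].
  by rewrite mem_cat => /orP[/tS //|/s0S[]].
have /spans_cons[c vc] := Ss v Sv.
have [w tw wc] := tr c (Ir c (ex_intro2 _ _ v Sv vc)).
have /S0s : S0 (v - w).
  split.
    apply: submoduleB => //; apply: spans_sub tw => y; exact: tS.
  have -> : v - w = (v - c *: x) - (w - c *: x) by rewrite opprB subrKA.
  exact: submoduleB.
move=> vw; rewrite -(subrK w v); apply: submoduleD.
  by apply: spans_sub vw => y ys; apply: mem_spans; rewrite mem_cat ys orbT.
by apply: spans_sub tw => y ys; apply: mem_spans; rewrite mem_cat ys.
Qed.

Lemma fin_gen_submod V (S : submodule V) : fin_gen V -> fg_submod S.
Proof. by case=> s sV; apply: (@noeth_submod _ s) => v _; apply: sV. Qed.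

Lemma fin_gen_inj V W (f : {linear V -> W}) :
  injective f -> fin_gen W -> fin_gen V.
Proof.
move=> fi Wfg; have /fg_submod_fin_gen := fin_gen_submod (image_submod f) Wfg.
have [x|h hE] := factor_inj (h := submod_val (image_submod f)) fi.
  exact: (submod_valP x).
apply: (fin_gen_surj (f := h)) => v.
 have [|x xE] := @submod_val_ex _ _ (image_submod f) (f v); first by exists v.
by exists x; apply: fi; rewrite hE.
Qed.

(** A family of submodules with no maximal element would give, by dependent
    choice, a strictly increasing sequence; its union is finitely generated, so
    the sequence stops. *)
Lemma noeth_max V (F : submodule V -> Prop) S :
    fin_gen V -> F S ->
  exists T, [/\ F T, forall v, S v -> T v &
    forall T', F T' -> (forall v, T v -> T' v) -> forall v, T' v -> T v].
Proof.
move=> Vfg FS.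
pose G := {T : submodule V | F T /\ (forall v, S v -> T v)}.
have [//|noM] := pselect (exists T, [/\ F T, forall v, S v -> T v &
    forall T', F T' -> (forall v, T v -> T' v) -> forall v, T' v -> T v]).
have step (T : G) : exists T' : G, (forall v, sval T v -> sval T' v) /\
    exists2 v, sval T' v & ~ sval T v.
  apply: contrapT => noT; apply: noM; exists (sval T).
  case: T noT => T [FT ST] /= noT; split=> // T' FT' TT' v T'v.
  apply: contrapT => Tv; apply: noT.
  have H : F T' /\ (forall v, S v -> T' v) by split=> // u /ST/TT'.
  by exists (exist _ T' H); split=> //; exists v.
pose T0 : G := exist _ S (conj FS (fun v Sv => Sv)).
pose nx (T : G) : G := sval (cid (step T)).
have nxP (T : G) : (forall v, sval T v -> sval (nx T) v) /\
    exists2 v, sval (nx T) v & ~ sval T v by rewrite /nx; case: cid.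
pose c k := iter k nx T0.
have cS k l : (k <= l)%N -> forall v, sval (c k) v -> sval (c l) v.
  move=> /subnK <-; elim: (l - k)%N => //= j IH v /IH.
  by case: (nxP (c (j + k)%N)) => + _; exact.
have @U : submodule V.
  exists (fun v => exists k, sval (c k) v).
    by exists 0%N; exact: submodule0.
  move=> a u v [k uk] [l vl]; exists (maxn k l).
  by apply: submoduleP; [apply: cS uk; exact: leq_maxl | apply: cS vl; exact: leq_maxr].
have [s sU Us] := fin_gen_submod U Vfg.
have [k sk] : exists k, forall x, x \in s -> sval (c k) x.
  elim: s sU {Us} => [|x s IH] sU; first by exists 0%N.
  have [|k sk] := IH; first by move=> y ys; apply: sU; rewrite inE ys orbT.
  have [l xl] := sU x (mem_head _ _); exists (maxn k l) => y.
  rewrite inE => /orP[/eqP ->|/sk]; first by apply: (cS) xl; exact: leq_maxr.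
  by apply: (cS); exact: leq_maxl.
have [_ [v vk1 vk]] := nxP (c k); case: vk.
by apply: spans_sub sk _; apply: Us; exists k.+1.
Qed.

End Noetherian.
End FinGen.

(** * Noetherian local rings *)

Section PrimeIdeals.
Variable R : comNzRingType.

Definition prime_submod (P : submodule R^o) :=
  ~ P 1 /\ forall a b : R, P (a * b) -> P a \/ P b.

Definition prime_pred (P : submodule R^o) (_ : prime_submod P) : {pred R} :=
  fun x => `[< P x >].

Lemma prime_pred_idealr P (hP : prime_submod P) : idealr_closed (prime_pred hP).
Proof.
split; first by apply/asboolP/(submodule0 P).
  by apply/asboolP; case: hP.
by move=> a u v /asboolP Pu /asboolP Pv; apply/asboolP/(submoduleP a Pu Pv).
Qed.

Lemma prime_pred_prime P (hP : prime_submod P) : prime_idealr_closed (prime_pred hP).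
Proof.
move=> u v /asboolP Puv; have [_ hPM] := hP.
by apply/orP; case: (hPM _ _ Puv) => h; [left | right]; exact/asboolP.
Qed.

HB.instance Definition _ P (hP : prime_submod P) :=
  isIdealr.Build R (prime_pred hP) (prime_pred_idealr hP).
HB.instance Definition _ P (hP : prime_submod P) :=
  isPrimeIdealrClosed.Build R (prime_pred hP) (@prime_pred_prime P hP).

Definition prime_of P (hP : prime_submod P) : prime_idealr R := prime_pred hP.

Lemma prime_ofE P (hP : prime_submod P) x : (x \in prime_of hP) = `[< P x >].
Proof. by []. Qed.

Lemma fin_gen_regular : fin_gen (R^o : lmodType R).
Proof.
exists [:: 1] => x; exists (fun=> x).
by rewrite big_ord_recl big_ord0 addr0 /= -[RHS]/(x * 1) mulr1.
Qed.

Hypothesis R_noeth : noetherian R.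

(** An ideal maximal among those disjoint from a multiplicative set is prime. *)
Lemma prime_disjoint (I : submodule R^o) (S : R -> Prop) :
    S 1 -> (forall a b, S a -> S b -> S (a * b)) -> (forall a, I a -> ~ S a) ->
  exists P, [/\ prime_submod P, forall a, I a -> P a & forall a, P a -> ~ S a].
Proof.
move=> S1 SM IS.
have [P [PS IP Pmax]] :=
  noeth_max (F := fun T : submodule R^o => forall a, T a -> ~ S a) R_noeth fin_gen_regular IS.
exists P; split=> //; split=> [/PS //|a b Pab].
apply: contrapT => /not_orP[Pa Pb].
have meet c : ~ P c -> exists s r, S s /\ P (s - r * c).
  move=> Pc; apply: contrapT => noS; apply: Pc.
  pose T := add_submod P (spans [:: (c : R^o)]).
  apply: (Pmax T) => [s [t [u [Pt [d]]]]|s Ps|].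
  - rewrite big_ord_recl big_ord0 addr0 /= => -> -> Ss; apply: noS.
    exists (t + d 0%N *: (c : R^o)), (d 0%N); split=> //.
    by rewrite -[_ *: _]/(_ * _) addrK.
  - by exists s, 0; split; rewrite ?addr0 //; exact: submodule0.
  - exists 0, c; split; rewrite ?add0r //; first exact: submodule0.
    by apply: mem_spans; rewrite mem_head.
have [s [r [Ss Ps]]] := meet a Pa; have [s' [r' [Ss' Ps']]] := meet b Pb.
apply: (PS (s * s')); last exact: SM.
have -> : s * s' = s' *: (s - r * a : R^o) + ((r * a) *: (s' - r' * b : R^o)
   + (r * r') *: (a * b : R^o)).
  rewrite -![_ *: _]/(_ * _) !mulrBr [s' * s]mulrC.
  have -> : r * a * (r' * b) = r * r' * (a * b) by rewrite mulrACA.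
  by rewrite subrK [r * a * s']mulrC subrK.
apply: submoduleD; first exact: submoduleZ.
by apply: submoduleD; apply: submoduleZ.
Qed.

Definition ideal_mul_submod (E : lmodType R) (xs : seq R) : submodule E.
Proof.
exists (ideal_mul xs (E := E)).
  by exists (fun=> 0); rewrite big1 // => i _; rewrite scaler0.
move=> a u v [e ->] [f ->]; exists (fun i => a *: e i + f i).
rewrite scaler_sumr -big_split /=; apply: eq_bigr => i _.
by rewrite scalerDr !scalerA mulrC.
Defined.

Lemma ideal_mul_nil (E : lmodType R) (v : E) : ideal_mul [::] v <-> v = 0.
Proof.
by split=> [[e ->]|->]; [rewrite big_ord0 | exists (fun=> 0); rewrite big_ord0].
Qed.

Lemma ideal_mul_rcons (E : lmodType R) xs x (v : E) :
  ideal_mul (rcons xs x) v <-> exists w, ideal_mul xs (v - x *: w).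
Proof.
split=> [[e ->]|[w [e /eqP]]].
  exists (e (size xs)), e; rewrite size_rcons big_ord_recr /=.
  rewrite nth_rcons ltnn eqxx addrK; apply: eq_bigr => i _.
  by rewrite nth_rcons ltn_ord.
rewrite subr_eq => /eqP ->; exists (fun i => if (i < size xs)%N then e i else w).
rewrite size_rcons big_ord_recr /= nth_rcons !ltnn eqxx; congr (_ + _).
by apply: eq_bigr => i _; rewrite nth_rcons ltn_ord.
Qed.

(** The next prime below [P] comes from the multiplicative set of the
    [s * x ^+ k], [s] outside [P]: regularity of the last element [x] says that
    this set does not meet the ideal of the previous ones, so some prime inside
    [P] contains these but not [x]. *)
Lemma regular_seq_chain (xs : seq R) (P : submodule R^o) (hP : prime_submod P) :
    (forall i, (i < size xs)%N -> forall v : R^o,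
      ideal_mul (take i xs) (xs`_i *: v) -> ideal_mul (take i xs) v) ->
    (forall x, x \in xs -> P x) ->
  exists2 p, prime_chain (size xs) p & p (size xs) =i prime_of hP.
Proof.
elim/last_ind: xs P hP => [|ys x IH] P hP reg xsP.
  by exists (fun=> prime_of hP) => // i.
pose S s := exists a k, ~ P a /\ s = a * x ^+ k.
have regx (v : R^o) : ideal_mul ys (x *: v) -> ideal_mul ys v.
  have := reg (size ys); rewrite size_rcons ltnSn => /(_ isT v).
  by rewrite -cats1 take_size_cat // nth_cat ltnn subnn.
have [//|||Q [hQ ysQ QS]] := @prime_disjoint (ideal_mul_submod R^o ys) S.
- by exists 1, 0%N; case: hP; rewrite mulr1.
- move=> _ _ [a [k [Pa ->]]] [b [l [Pb ->]]]; exists (a * b), (k + l)%N.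
  rewrite mulrACA exprD; split=> // Pab; have [_ hPM] := hP.
  by case: (hPM _ _ Pab).
- move=> s Ia [a [k [Pa sE]]]; apply: Pa; rewrite {}sE in Ia.
  elim: k Ia => [|k IHk Ia]; last first.
    by apply/IHk/regx; rewrite -[_ *: _]/(_ * _) mulrCA -exprS.
  rewrite mulr1 => -[e ->]; apply: submodule_sum => i _.
  rewrite -[_ *: _]/(_ * _) mulrC; apply: (@submoduleZ _ _ P _ (ys`_i : R^o)).
  by apply: xsP; rewrite mem_rcons inE mem_nth ?orbT.
have QP a : Q a -> P a.
  by move=> Qa; apply: contrapT => Pa; apply: (QS _ Qa); exists a, 0%N; rewrite mulr1.
have Qx : ~ Q x.
  move=> Qx; apply: (QS _ Qx); exists 1, 1%N; rewrite mul1r; split=> //.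
  by case: hP.
have [||p pc pQ] := IH Q hQ.
- move=> i ilt v; have := reg i; rewrite size_rcons ltnS (ltnW ilt) => /(_ isT v).
  by rewrite -cats1 takel_cat ?(ltnW ilt) // nth_cat ilt.
- move=> y ysy; apply: ysQ; have := nth_index 0 ysy; set j := index y ys => yE.
  have jlt : (j < size ys)%N by rewrite index_mem.
  exists (fun i => if i == j then 1 else 0); rewrite (bigD1 (Ordinal jlt)) //= eqxx.
  rewrite big1 ?addr0; last by move=> i /eqP/val_eqP/= /negbTE ->; rewrite scaler0.
  by rewrite -[RHS]/(_ * _) mulr1 yE.
exists (fun i => if (i <= size ys)%N then p i else prime_of hP); last first.
  by move=> y; rewrite size_rcons ltnn.
move=> i; rewrite size_rcons ltnS leq_eqVlt => /orP[/eqP ->|ilt].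
  rewrite /= eqxx ltnn; split=> [a|sub].
    by rewrite pQ => /asboolP/QP Pa; apply/asboolP.
  apply: Qx; apply/asboolP; rewrite -(prime_ofE hQ) -pQ; apply: sub.
  by apply/asboolP/xsP; rewrite mem_rcons mem_head.
by rewrite /= ilt orbT; exact: pc.
Qed.

End PrimeIdeals.

Section LocalRing.
Variables (R : comNzRingType) (m : {pred R}).
Hypothesis R_noeth : noetherian R.
Hypothesis R_local : local_ring m.

Definition max_submod : submodule R^o.
Proof.
exists (fun x : R^o => is_true ((x : R) \in m)); by case: R_local => -[[]].
Defined.

Lemma max1 : 1 \notin m.
Proof. by case: R_local => -[[]]. Qed.

Lemma maxZ a x : x \in m -> a * x \in m.
Proof. exact: (submoduleZ (S := max_submod)). Qed.

Lemma maxB x y : x \in m -> y \in m -> x - y \in m.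
Proof. exact: (submoduleB (S := max_submod)). Qed.

Lemma proper_ideal_sub_max (I : submodule R^o) x : ~ I 1 -> I x -> x \in m.
Proof.
move=> I1 Ix.
have [J [J1 IJ Jmax]] :=
  noeth_max (F := fun T : submodule R^o => ~ T 1) R_noeth (fin_gen_regular R) I1.
pose Jp : {pred R} := fun y => `[< J y >].
have Jid : idealr_closed Jp.
  split; [by apply/asboolP/(submodule0 J) | by apply/asboolP |].
  by move=> a u v /asboolP Ju /asboolP Jv; apply/asboolP/(submoduleP a Ju Jv).
case: R_local => _ /(_ Jp) <-; first exact/asboolP/IJ.
split=> // K [K0 K1 KD] JK y Ky; apply/asboolP.
have @K' : submodule R^o.
  by exists (fun y : R^o => is_true ((y : R) \in K)) => // a u v; exact: KD.
apply: (Jmax K') => //; first by move=> /= h; rewrite h in K1.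
by move=> v Jv; apply: JK; apply/asboolP.
Qed.

Lemma notin_max_unit x : x \notin m -> exists y, y * x = 1.
Proof.
move=> xm; apply: contrapT => noy; move/negP: xm; apply.
apply: (@proper_ideal_sub_max (spans [:: (x : R^o)])); last first.
  by apply: mem_spans; rewrite mem_head.
by move=> [c]; rewrite big_ord_recl big_ord0 addr0 /= => xE; apply: noy; exists (c 0%N).
Qed.

Lemma max_prime : prime_submod max_submod.
Proof.
split=> [/= h|/= a b ab]; first by have := max1; rewrite h.
have [|/notin_max_unit[y ya]] := boolP (a \in m); [by left | right].
by rewrite -[b]mul1r -ya -mulrA; apply: maxZ.
Qed.

Lemma one_sub_max_unit x : x \in m -> exists y, y * (1 - x) = 1.
Proof.
move=> xm; apply: notin_max_unit; apply/negP => h.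
have := max1; rewrite -[1](subrK x) -[x in _ + x]opprK maxB //.
by rewrite -[- x]mulN1r maxZ.
Qed.

(** Nakayama's lemma for the subquotient [(Z + B) / B].  The hypothesis
    [Z <= m Z + B] is phrased through all submodules [T] containing [m Z + B].
    A generator lying in [m Z + B] is redundant, because [1 - a] is a unit for
    every [a] in [m]. *)
Lemma nakayama (V : lmodType R) (Z B : submodule V) (s : seq V) :
    (forall x, x \in s -> Z x) ->
    (forall z, Z z -> exists2 b, B b & spans s (z - b)) ->
    (forall z, Z z -> forall T : submodule V, (forall b, B b -> T b) ->
      (forall a w, a \in m -> Z w -> T (a *: w)) -> T z) ->
  forall z, Z z -> B z.
Proof.
elim: s => [|x s IH] sZ sB ZmZ.
  by move=> z /sB[b Bb /spans_nil/eqP]; rewrite subr_eq0 => /eqP ->.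
apply: IH => //; first by move=> y ys; apply: sZ; rewrite inE ys orbT.
have [a [b [am Bb xab]]] : exists a b, [/\ a \in m, B b & spans s (x - b - a *: x)].
  have @T : submodule V.
    exists (fun v => exists a b, [/\ a \in m, B b & spans s (v - b - a *: x)]).
      exists 0, 0; split; first exact: (submodule0 max_submod).
        exact: submodule0.
      by rewrite scale0r !subr0; exact: submodule0.
    move=> c u v [a [b [am Bb ub]]] [a' [b' [a'm Bb' vb']]].
    exists (c * a + a'), (c *: b + b'); split.
    - exact: (@submoduleP _ _ max_submod c a a').
    - exact: submoduleP.
    have -> : c *: u + v - (c *: b + b') - (c * a + a') *: x =
        c *: (u - b - a *: x) + (v - b' - a' *: x).
      rewrite !scalerBr scalerDl scalerA !opprD.
      by rewrite [c *: u + v + _]addrACA [LHS]addrACA.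
    exact: submoduleP.
  apply: (ZmZ x (sZ x (mem_head _ _)) T) => [b Bb|a w am Zw].
    exists 0, b; split=> //; first exact: (submodule0 max_submod).
    by rewrite subrr scale0r subr0; exact: submodule0.
  have [b Bb /spans_cons[c wc]] := sB w Zw.
  exists (a * c), (a *: b); split; [by rewrite mulrC maxZ|exact: submoduleZ|].
  by rewrite -scalerA -!scalerBr; apply: submoduleZ.
have [y yE] := one_sub_max_unit am.
have {}xab : spans s (x - y *: b).
  have -> : x - y *: b = y *: (x - b - a *: x).
    rewrite addrAC scalerBr; congr (_ - _).
    have -> : x - a *: x = (1 - a) *: x by rewrite scalerBl scale1r.
    by rewrite scalerA yE scale1r.
  exact: submoduleZ.
move=> z /sB[b' Bb' /spans_cons[c zc]].
exists (b' + c *: (y *: b)).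
  by apply: submoduleD => //; apply: submoduleZ; apply: submoduleZ.
have -> : z - (b' + c *: (y *: b)) = (z - b' - c *: x) + c *: (x - y *: b).
  by rewrite scalerBr addrA subrK opprD addrA.
by apply: submoduleD => //; apply: submoduleZ.
Qed.

(** A surjection from a free module of least rank: a relation with a unit
    coefficient would make a generator redundant. *)
Lemma minimal_cover (M : lmodType R) : fin_gen M ->
  exists n (p : {linear 'rV[R]_n -> M}), onto p /\
    forall v, p v = 0 -> forall i, v 0 i \in m.
Proof.
move=> [s sM].
have ex : exists n, `[< exists p : {linear 'rV[R]_n -> M}, onto p >].
  by exists (size s); apply/asboolP; exists (@comb R M s); apply: comb_surj.
case: (ex_minnP ex) => n /asboolP[p ps] nmin; exists n, p; split=> // v pv i.
have [//|/notin_max_unit[y yv]] := boolP (v 0 i \in m).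
case: n p ps v pv i yv nmin => [|n] p ps v pv i yv nmin; first by case: i yv.
suff /nmin : `[< exists p : {linear 'rV[R]_n -> M}, onto p >] by rewrite ltnn.
apply/asboolP; exists (p \o mulmxr (row' i 1%:M)) => x.
have [u <-] := ps x; pose w := u - (u 0 i * y) *: v.
have wi : w 0 i = 0 by rewrite !mxE -mulrA yv mulr1 subrr.
have pw : p w = p u by rewrite linearB linearZ /= pv scaler0 subr0.
exists (col' i w) => /=; clearbody w.
have -> : col' i w *m row' i 1%:M = w.
  apply/rowP => j; rewrite !mxE; under eq_bigr do rewrite !mxE.
  case: (unliftP i j) => [k ->|->].
    rewrite (bigD1 k) //= eqxx mulr1 big1 ?addr0 // => l lk.
    by rewrite (inj_eq lift_inj) (negbTE lk) mulr0.
  by rewrite wi big1 // => l _; rewrite eq_sym (negbTE (neq_lift _ _)) mulr0.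
by rewrite pw.
Qed.

End LocalRing.

(** * Elements that are regular on a module *)

Section RegularElement.
Variables (R : comNzRingType) (Q : lmodType R).
Hypothesis R_noeth : noetherian R.
Hypothesis Q_fg : fin_gen Q.

Definition annihilator (z : Q) : submodule R^o.
Proof.
exists (fun a => a *: z = 0); first by rewrite scale0r.
move=> a u v uz vz; rewrite scalerDl vz addr0 -[a *: u]/(a * u).
by rewrite -scalerA uz scaler0.
Defined.

(** The annihilators of such elements are the maximal associated primes of [Q]. *)
Definition max_ann (z : Q) := z <> 0 /\ forall w : Q, w <> 0 ->
  (forall a, a *: z = 0 -> a *: w = 0) -> forall a, a *: w = 0 -> a *: z = 0.

Lemma max_ann_ex (z : Q) : z <> 0 ->
  exists2 w, max_ann w & forall a, a *: z = 0 -> a *: w = 0.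
Proof.
move=> z0; pose F (T : submodule R^o) := exists2 w : Q, w <> 0 & forall a, T a <-> a *: w = 0.
have Fz : F (annihilator z) by exists z.
have [T [[w w0 Tw] zT Tmax]] := noeth_max (F := F) R_noeth (fin_gen_regular R) Fz.
exists w => [|a /zT/Tw //]; split=> // u u0 wu a au.
by apply/Tw; apply: (Tmax (annihilator u)) => //; [exists u|move=> b /Tw/wu].
Qed.

Lemma max_ann_prime (z : Q) a b : max_ann z -> (a * b) *: z = 0 -> a *: z = 0 \/ b *: z = 0.
Proof.
move=> [z0 zmax] abz; have [?|bz0] := pselect (b *: z = 0); [by right|left].
apply: (zmax (b *: z)); rewrite ?scalerA // => c cz.
by rewrite scalerA mulrC -scalerA cz scaler0.
Qed.

(* The product of the separating elements works, the annihilator of z being prime *)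
Lemma separate (z : Q) (zs : seq Q) : max_ann z ->
    (forall y, y \in zs -> exists2 a, a *: y = 0 & a *: z <> 0) ->
  exists2 a, (forall y, y \in zs -> a *: y = 0) & a *: z <> 0.
Proof.
move=> zm; elim: zs => [|y zs IH] zs_sep.
  by exists 1 => //; rewrite scale1r; case: zm.
have [|a azs az] := IH; first by move=> x xs; apply: zs_sep; rewrite inE xs orbT.
have [b bys bz] := zs_sep y (mem_head _ _); exists (a * b).
  move=> x; rewrite inE => /orP[/eqP ->|/azs xs]; first by rewrite -scalerA bys scaler0.
  by rewrite mulrC -scalerA xs scaler0.
by case/(max_ann_prime zm).
Qed.

(** Finitely many elements [zs] generate the submodule spanned by all elements
    with maximal annihilator; a maximal (hence prime) annihilator contains the
    intersection of those of [zs], so it contains one of them. *)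
Lemma max_ann_finite : exists2 zs : seq Q, (forall z, z \in zs -> max_ann z) &
  forall z, max_ann z -> exists2 y, y \in zs & forall a, a *: y = 0 -> a *: z = 0.
Proof.
pose F (T : submodule Q) := exists2 zs : seq Q, (forall z, z \in zs -> max_ann z) &
  forall v, T v <-> spans zs v.
have F0 : F (spans [::]) by exists [::].
have [T [[zs zsm Tzs] _ Tmax]] := noeth_max (F := F) R_noeth Q_fg F0.
exists zs => // z zm; apply: contrapT => noy.
have zz : spans zs z.
  apply/Tzs/(Tmax (spans (z :: zs))).
  - by exists (z :: zs) => // y; rewrite inE => /orP[/eqP -> //|/zsm].
  - by move=> v /Tzs sv; apply/spans_cons; exists 0; rewrite scale0r subr0.
  - by apply: mem_spans; rewrite mem_head.
have [|a azs []] := @separate z zs zm.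
  move=> y yzs; apply: contrapT => noa; apply: noy; exists y => // a ay.
  by apply: contrapT => az; apply: noa; exists a.
have @A : submodule Q.
  exists (fun v => a *: v = 0); first by rewrite scaler0.
  move=> c u v au av.
  by rewrite scalerDr av addr0 scalerA mulrC -scalerA au scaler0.
exact: (spans_sub (S := A) azs zz).
Qed.

(** Prime avoidance for annihilators.  If [x] avoids those of [zs] but kills [y],
    add to it an element killing [zs] and not [y]: it exists because, by
    maximality, an annihilator contained in that of [y] would contain [x]. *)
Lemma max_ann_avoid (I : submodule R^o) (zs : seq Q) :
    (forall z, z \in zs -> max_ann z) ->
    (forall z, z \in zs -> exists2 x, I x & x *: z <> 0) ->
  exists2 x, I x & forall z, z \in zs -> x *: z <> 0.
Proof.
elim: zs => [|y zs IH] zsm Izs; first by exists 0 => //; exact: submodule0.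
have [||x Ix xzs] := IH.
- by move=> z zzs; apply: zsm; rewrite inE zzs orbT.
- by move=> z zzs; apply: Izs; rewrite inE zzs orbT.
have ym : max_ann y by apply: zsm; rewrite mem_head.
have [xy|xy] := pselect (x *: y = 0); last first.
  by exists x => // z; rewrite inE => /orP[/eqP -> //|/xzs].
have [|a azs ay] := @separate y zs ym.
  move=> z zzs; apply: contrapT => noa.
  have zm : max_ann z by apply: zsm; rewrite inE zzs orbT.
  case: (xzs z zzs); case: zm => z0; apply=> [|a az|]; last exact: xy.
    by case: ym.
  by apply: contrapT => ay; apply: noa; exists a.
have [x0 Ix0 x0y] := Izs y (mem_head _ _); exists (x + a * x0).
  by apply: submoduleD => //; exact: submoduleZ.
move=> z; rewrite inE scalerDl => /orP[/eqP ->|zzs].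
  by rewrite xy add0r => /(max_ann_prime ym) [].
by rewrite mulrC -scalerA azs // scaler0 addr0; apply: xzs.
Qed.

(** The zero divisors on [Q] are the union of finitely many maximal
    annihilators; an ideal inside this union is inside one of them. *)
Lemma regular_element (I : submodule R^o) :
    (forall w : Q, (forall x, I x -> x *: w = 0) -> w = 0) ->
  exists2 x, I x & forall v : Q, x *: v = 0 -> v = 0.
Proof.
move=> Isoc; have [zs zsm zsE] := max_ann_finite.
have [//||x Ix xzs] := @max_ann_avoid I zs.
  move=> z zzs; apply: contrapT => nox; case: (zsm z zzs) => z0 _; apply: z0.
  by apply: Isoc => x Ix; apply: contrapT => xz; apply: nox; exists x.
exists x => // v xv; apply: contrapT => v0.
have [w wm vw] := max_ann_ex v0; have [y yzs yw] := zsE w wm.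
apply: (xzs y yzs); have [w0 _] := wm; have [y0 ymax] := zsm y yzs.
by apply: (ymax w) => //; exact: vw.
Qed.

End RegularElement.

(** * Vanishing of Ext computed by an injective resolution *)

Section ExtVanishing.
Variables (R : comNzRingType) (W : lmodType R) (I : inj_resolution W).
Implicit Types A B C N : lmodType R.

Local Notation d := (ires_diff I).

(** Says that Ext^(i+1) (N, W) = 0: every cocycle in Hom (N, I_(i+1)) is a
    coboundary.  The exactness of Hom (-, I_i) makes the consequences of the long
    exact sequence below immediate. *)
Definition ext_vanishes (i : nat) (N : lmodType R) :=
  forall g : {linear N -> I i.+1}, (forall x, d i.+1 (g x) = 0) ->
  exists h : {linear N -> I i}, forall x, d i (h x) = g x.

Lemma ires_extend A B i (f : {linear A -> B}) (g : {linear A -> I i}) :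
  injective f -> exists h : {linear B -> I i}, forall x, h (f x) = g x.
Proof. exact: ires_injective. Qed.

Lemma ires_dd i x : d i.+1 (d i x) = 0.
Proof. by apply/ires_exact; exists x. Qed.

Section ShortExact.
Variables (A B C : lmodType R) (f : {linear A -> B}) (p : {linear B -> C}).
Hypothesis fp : short_exact f p.

Lemma short_exact0 x : p (f x) = 0.
Proof. by case: fp => _ _ ex; apply/ex; exists x. Qed.

(* The universal property of the cokernel *)
Lemma short_exact_factor (V : lmodType R) (g : {linear B -> V}) : (forall a, g (f a) = 0) ->
  exists h : {linear C -> V}, forall b, h (p b) = g b.
Proof.
by case: fp => _ ps ex gf; apply: factor_surj => // b /ex[a <-].
Qed.

Lemma ext_vanishes_mid i : ext_vanishes i A -> ext_vanishes i C -> ext_vanishes i B.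
Proof.
move=> vA vC g gc; have [fi ps _] := fp.
have [|h hE] := vA (g \o f : {linear A -> _}); first by move=> x /=; apply: gc.
have [h' h'E] := ires_extend h fi.
have [a|k kE] := @short_exact_factor _ (g \- (d i \o h')).
  by rewrite /= h'E hE /= subrr.
have [c|l lE] := vC k.
  by have [b <-] := ps c; rewrite kE /= linearB gc ires_dd subrr.
exists (h' \+ (l \o p)) => x.
by rewrite /= linearD lE kE /= addrC subrK.
Qed.

Lemma ext_vanishes_right i :
  ext_vanishes i A -> ext_vanishes i.+1 B -> ext_vanishes i.+1 C.
Proof.
move=> vA vB g gc; have [fi ps _] := fp.
have [x|h hE] := vB (g \o p : {linear B -> _}); first exact: gc.
have [x|k kE] := vA (h \o f : {linear A -> _}).
  by rewrite /= hE /= short_exact0 linear0.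
have [k' k'E] := ires_extend k fi.
have [a|l lE] := @short_exact_factor _ (h \- (d i \o k')).
  by rewrite /= k'E kE subrr.
exists l => c; have [b <-] := ps c.
by rewrite lE /= linearB hE ires_dd subr0.
Qed.

Lemma ext_vanishes_left i :
  ext_vanishes i.+1 C -> ext_vanishes i B -> ext_vanishes i A.
Proof.
move=> vC vB g gc; have [fi ps _] := fp.
have [g' g'E] := ires_extend g fi.
have [a|k kE] := @short_exact_factor _ (d i.+1 \o g').
  by rewrite /= g'E gc.
have [c|h hE] := vC k.
  by have [b <-] := ps c; rewrite kE /= ires_dd.
have [x|l lE] := vB (g' \- (h \o p)).
  by rewrite /= linearB hE kE /= subrr.
exists (l \o f) => x.
by rewrite /= lE /= short_exact0 linear0 subr0 g'E.
Qed.

End ShortExact.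

Lemma ext_vanishes_projective i P : projective_module P -> ext_vanishes i P.
Proof.
by move=> Pp g; apply: projective_lift Pp (@ires_exact _ _ I i).
Qed.

Lemma ext_vanishes_iso i A B (f : {linear A -> B}) :
  injective f -> onto f -> ext_vanishes i A -> ext_vanishes i B.
Proof.
move=> fi fs vA g gc.
have [x|h hE] := vA (g \o f); first exact: gc.
have [b|k kE] := @factor_surj _ _ _ _ f h fs.
  by rewrite -(linear0 f) => /fi ->; rewrite linear0.
by exists k => b; have [a <-] := fs b; rewrite kE hE.
Qed.

Lemma ext_vanishes_zero i N : zero_module N -> ext_vanishes i N.
Proof.
move=> N0 g _; exists (\0 : {linear N -> I i}) => x.
by rewrite (N0 x) !linear0.
Qed.

Lemma ext_vanishes_bounded i N : zero_module (I i.+1) -> ext_vanishes i N.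
Proof.
move=> I0 g _; exists (\0 : {linear N -> I i}) => x.
by rewrite (I0 (g x)) linear0.
Qed.

End ExtVanishing.

(** * Linear maps as elements of the module of homomorphisms *)

Section HomElements.
Variables (R : comNzRingType) (U V : lmodType R).

Lemma hom_of_pred (f : {linear U -> V}) : (f : U -> V) \in @linear_pred R U V.
Proof. by apply/asboolP => a u v; rewrite linearP. Qed.

Definition hom_of (f : {linear U -> V}) : Hom_module U V := SubModule (hom_of_pred f).

Lemma hom_linear (F : Hom_module U V) : linear (val F).
Proof. exact/asboolP/(valP F). Qed.

Definition lin_of (F : Hom_module U V) : {linear U -> V} := mk_linear (@hom_linear F).

Lemma hom_ofE f x : val (hom_of f) x = f x. Proof. by []. Qed.
Lemma lin_ofE F x : lin_of F x = val F x. Proof. by []. Qed.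

Lemma homP (F G : Hom_module U V) : (forall x, val F x = val G x) -> F = G.
Proof. by move=> FG; apply: val_inj; apply/funext. Qed.

Lemma homD (F G : Hom_module U V) x : val (F + G) x = val F x + val G x.
Proof. by []. Qed.
Lemma homZ a (F : Hom_module U V) x : val (a *: F) x = a *: val F x.
Proof. by []. Qed.
Lemma homN (F : Hom_module U V) x : val (- F) x = - val F x.
Proof. by []. Qed.
Lemma hom0 x : val (0 : Hom_module U V) x = 0.
Proof. by []. Qed.

Definition scale_map (a : R) : {linear V -> V}.
Proof.
apply: (@mk_linear _ _ _ (fun v => a *: v)).
by move=> b u v; rewrite scalerDr !scalerA mulrC.
Defined.

Lemma scale_mapE a v : scale_map a v = a *: v.
Proof. by []. Qed.

Definition line_map (v : V) : {linear R^o -> V}.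
Proof.
apply: (@mk_linear _ _ _ (fun a : R^o => (a : R) *: v)).
by move=> c a b; rewrite scalerDl -scalerA.
Defined.

Lemma line_mapE v (a : R) : line_map v a = a *: v.
Proof. by []. Qed.

End HomElements.

Section FreeCovers.
Variable R : comNzRingType.

Lemma projective_rV n : projective_module ('rV[R]_n : lmodType R).
Proof.
move=> A B g f gs; pose a i := sval (cid (gs (f (delta_mx 0 i)))).
have aE i : g (a i) = f (delta_mx 0 i) by rewrite /a; case: cid.
have l : linear (fun v : 'rV[R]_n => \sum_i v 0 i *: a i).
  move=> c u v; rewrite scaler_sumr -big_split; apply: eq_bigr => i _ /=.
  by rewrite !mxE scalerDl scalerA.
exists (mk_linear l) => v; rewrite mk_linearE linear_sum {2}(row_sum_delta v) linear_sum.
by apply: eq_bigr => i _; rewrite !linearZ aE.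
Qed.

Lemma projective_regular : projective_module (R^o : lmodType R).
Proof.
move=> A B g f gs; have [a aE] := gs (f 1).
have l : linear (fun c : R^o => (c : R) *: a).
  by move=> c u v; rewrite scalerDl -scalerA.
exists (mk_linear l) => c; rewrite mk_linearE linearZ /= aE.
by rewrite -linearZ -[c%:A]/(c * 1) mulr1.
Qed.

Lemma rV_cover (N : lmodType R) : fin_gen N ->
  exists n (p : {linear 'rV[R]_n -> N}), onto p.
Proof. by move=> [s sN]; exists (size s), (@comb R N s); apply: comb_surj. Qed.

Hypothesis R_noeth : noetherian R.

Lemma fin_gen_hom (K : lmodType R) : fin_gen K -> fin_gen (Hom_module K (R^o : lmodType R)).
Proof.
move=> [s sK].
have l : linear (fun f : Hom_module K (R^o : lmodType R) => \row_(i < size s) (val f s`_i : R)).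
  by move=> a f g; apply/rowP => i; rewrite !mxE homD homZ.
apply: (fin_gen_inj R_noeth (f := mk_linear l)); last exact: fin_gen_rV.
apply: linear_inj => f; rewrite mk_linearE => /rowP f0; apply: homP => x.
have [c ->] := sK x; rewrite -!lin_ofE !linear_sum; apply: eq_bigr => i _.
rewrite !linearZ; congr (_ *: _); have := f0 i; rewrite !mxE; exact.
Qed.

End FreeCovers.

(** * Nakayama's lemma for Ext *)

Section ExtNakayama.
Variables (R : comNzRingType) (m : {pred R}).
Hypothesis R_noeth : noetherian R.
Hypothesis R_local : local_ring m.
Variable I : inj_resolution (R^o : lmodType R).

Local Notation d := (ires_diff I).

(** Dimension shifting along [0 -> K -> F -> N -> 0], [F] free, preserves the
    hypothesis [Ext = x Ext]; it leads to [Ext^1], which is the cokernel of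
    [Hom (F, R) -> Hom (K, R)], a quotient of a finitely generated module. *)
Lemma ext_nakayama i (N : lmodType R) x : x \in m -> fin_gen N ->
    (forall g : {linear N -> I i.+1}, (forall y, d i.+1 (g y) = 0) ->
      exists (c : {linear N -> I i.+1}) (h : {linear N -> I i}),
        (forall y, d i.+1 (c y) = 0) /\ forall y, g y = x *: c y + d i (h y)) ->
  ext_vanishes I i N.
Proof.
move=> xm; elim: i N => [|i IH] N Nfg Nx.
  have [n [p ps]] := rV_cover Nfg.
  pose K := submod (kernel_submod p); pose j : {linear K -> _} := submod_val (kernel_submod p).
  have jp : short_exact j p := kernel_short_exact ps; have [ji _ _] := jp.
  have Kfg : fin_gen K by apply: (fin_gen_inj R_noeth ji); exact: fin_gen_rV.
  have augK (X : lmodType R) (e : {linear X -> I 0%N}) : (forall k, d 0%N (e k) = 0) ->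
      exists f : {linear X -> R^o}, forall k, ires_aug I (f k) = e k.
    move=> de; apply: factor_inj; first exact: ires_aug_inj.
    by move=> k; have /ires_exact0[a aE] := de k; exists a.
  have daug a : d 0%N (ires_aug I a) = 0 by apply/ires_exact0; exists a.
  have [s sH] := fin_gen_hom R_noeth Kfg.
  have @Z : submodule (Hom_module K (R^o : lmodType R)) by exists (fun=> True).
  pose B := image_submod (Hom_precomp (N := (R^o : lmodType R)) j
    : {linear Hom_module _ _ -> Hom_module _ _}).
  have ZB : forall z, Z z -> B z.
    apply: (nakayama R_noeth R_local (s := s)) => // [z _|f _ T BT mT].
      by exists 0; [exact: submodule0 | rewrite subr0; exact: sH].
    have [g' g'E] := ires_extend (ires_aug I \o lin_of f : {linear K -> I 0%N}) ji.
    have [a|gb gbE] := short_exact_factor jp (g := d 0%N \o g').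
      by rewrite /= g'E /= daug.
    have [b|c [h [dc gbc]]] := Nx gb.
      by have [v <-] := ps b; rewrite gbE /= ires_dd.
    have [y|e eE] := ext_vanishes_projective (I := I) (@projective_rV R n) (g := c \o p).
      exact: dc.
    have [k|c' c'E] := augK _ (e \o j : {linear K -> _}).
      by rewrite /= eE /= (short_exact0 jp) linear0.
    have [y|u uE] := augK _ (g' \- x \*: e \- (h \o p) : {linear _ -> _}).
      rewrite /= !linearB linearZ /= eE -[d 0%N (g' y)]gbE gbc /=.
      by rewrite addrAC addrK subrr.
    have -> : f = x *: hom_of c' + hom_of (u \o j : {linear K -> _}).
      apply: homP => k; apply: (ires_aug_inj (i0 := I)).
      rewrite homD homZ !hom_ofE linearD linearZ /= c'E uE /= g'E /=.
      by rewrite (short_exact0 jp) linear0 subr0 addrC subrK.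
    apply: submoduleD; first exact: mT.
    by apply: BT; exists (hom_of u); apply: homP.
  move=> g gc.
  have [y|e eE] := ext_vanishes_projective (I := I) (@projective_rV R n) (g := g \o p).
    exact: gc.
  have [k|f fE] := augK _ (e \o j : {linear K -> _}).
    by rewrite /= eE /= (short_exact0 jp) linear0.
  have [U UE] := ZB (hom_of f) Logic.I.
  pose u := lin_of U; have uE k : u (j k) = f k by exact: (congr1 (fun F => val F k) UE).
  have [k|h hE] := short_exact_factor jp (g := e \- (ires_aug I \o u)).
    by rewrite -[LHS]/(e (j k) - ires_aug I (u (j k))) uE fE subrr.
  exists h => y; have [v <-] := ps y.
  by rewrite hE /= linearB eE /= daug subr0.
have [n [p ps]] := rV_cover Nfg.
pose K := submod (kernel_submod p); pose j : {linear K -> _} := submod_val (kernel_submod p).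
have jp : short_exact j p := kernel_short_exact ps; have [ji _ _] := jp.
have Kfg : fin_gen K by apply: (fin_gen_inj R_noeth ji); exact: fin_gen_rV.
have Fp j' := ext_vanishes_projective (I := I) (i := j') (@projective_rV R n).
apply: (ext_vanishes_right jp) => //; apply: IH => // g gc.
have [g' g'E] := ires_extend g ji.
have [a|gb gbE] := short_exact_factor jp (g := d i.+1 \o g'); first by rewrite /= g'E.
have [b|c [h [dc gbc]]] := Nx gb.
  by have [v <-] := ps b; rewrite gbE /= ires_dd.
have [y|e eE] := Fp i.+1 (c \o p); first exact: dc.
have [y|u uE] := Fp i (g' \- x \*: e \- (h \o p) : {linear _ -> _}).
  rewrite /= !linearB linearZ /= eE -[d i.+1 (g' y)]gbE gbc /=.
  by rewrite addrAC addrK subrr.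
exists (e \o j), (u \o j); split=> [y|y]; first by rewrite /= eE /= (short_exact0 jp) linear0.
by rewrite /= uE /= g'E (short_exact0 jp) linear0 subr0 addrC subrK.
Qed.

(** The connecting map sends [Ext^(i+1) (N, R)] into [Ext^(i+2) (C, R)], so the
    vanishing of the latter makes multiplication by [x] surjective on the former. *)
Lemma ext_vanishes_regular i (N C : lmodType R) x (q : {linear N -> C}) :
  x \in m -> fin_gen N -> short_exact (scale_map N x) q ->
  ext_vanishes I i.+1 C -> ext_vanishes I i N.
Proof.
move=> xm Nfg xq vC; have [xi qs _] := xq.
apply: (ext_nakayama xm Nfg) => g gc.
have [g' g'E] := ires_extend g xi.
have [a|k kE] := short_exact_factor xq (g := d i.+1 \o g'); first by rewrite /= g'E.
have [c|h hE] := vC k.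
  by have [b <-] := qs c; rewrite kE /= ires_dd.
exists (g' \- (h \o q)), (\0 : {linear _ -> _}); split=> y.
  by rewrite /= linearB hE kE /= subrr.
rewrite /= linear0 addr0 scalerBr -!linearZ /= -[x *: y]/(scale_map N x y) g'E.
by rewrite (short_exact0 xq) linear0 subr0.
Qed.

End ExtNakayama.

(** * Injective dimension, Krull dimension and depth *)

Section InjectiveDimension.
Variables (R : comNzRingType) (m : {pred R}).
Hypothesis R_noeth : noetherian R.
Hypothesis R_local : local_ring m.
Variable I : inj_resolution (R^o : lmodType R).

Lemma quot_rcons (E : lmodType R) (xs : seq R) x :
    (forall v : E, ideal_mul xs (x *: v) -> ideal_mul xs v) ->
  exists q : {linear quotmod (ideal_mul_submod E xs) ->
                     quotmod (ideal_mul_submod E (rcons xs x))},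
    short_exact (scale_map _ x) q.
Proof.
move=> xreg; set S := ideal_mul_submod E xs; set T := ideal_mul_submod E (rcons xs x).
have ST v : S v -> T v.
  by move=> Sv; apply/ideal_mul_rcons; exists 0; rewrite scaler0 subr0.
have [v|q qE] := factor_surj (f := quotmod_proj T) (quotmod_proj_surj (S := S)).
  by move=> /quotmod_proj_eq0/ST/quotmod_proj_eq0.
exists q; split.
- apply: linear_inj => c; have [v <-] := quotmod_proj_surj c.
  by rewrite scale_mapE -linearZ => /quotmod_proj_eq0/xreg Sv; apply/quotmod_proj_eq0.
- by move=> c; have [v <-] := quotmod_proj_surj c; exists (quotmod_proj S v).
- move=> c; have [v <-] := quotmod_proj_surj c; rewrite qE.
  split=> [/quotmod_proj_eq0/ideal_mul_rcons[w vw]|[b]].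
    exists (quotmod_proj S w); apply/eqP; rewrite scale_mapE eq_sym -subr_eq0.
    by rewrite -linearZ -linearB; apply/eqP/quotmod_proj_eq0.
  have [w <-] := quotmod_proj_surj b; rewrite scale_mapE -linearZ => /eqP.
  rewrite eq_sym -subr_eq0 -linearB => /eqP/quotmod_proj_eq0 vw.
  by apply/quotmod_proj_eq0/ideal_mul_rcons; exists w.
Qed.

Lemma quot_nil (E : lmodType R) :
  injective (quotmod_proj (ideal_mul_submod E [::])).
Proof. by apply: linear_inj => v /quotmod_proj_eq0/ideal_mul_nil. Qed.

Section Step.
Variable i : nat.
Hypothesis ext_next : forall N : lmodType R, fin_gen N -> ext_vanishes I i.+1 N.

Lemma ext_vanishes_submod (A B : lmodType R) (f : {linear A -> B}) :
  injective f -> fin_gen B -> ext_vanishes I i B -> ext_vanishes I i A.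
Proof.
move=> fi Bfg; apply: (@ext_vanishes_left _ _ _ _ _ (quotmod (image_submod f)) f
  (quotmod_proj (image_submod f))); last first.
  by apply: ext_next; apply: fin_gen_surj Bfg; exact: quotmod_proj_surj.
split=> //; first exact: quotmod_proj_surj.
by move=> b; split=> [/quotmod_proj_eq0//|h]; apply/quotmod_proj_eq0.
Qed.

(* C is zero or a copy of the residue field *)
Lemma residue_embedding (C Q : lmodType R) (z : C) (w : Q) :
    (forall c, spans [:: z] c) -> (forall a, a \in m -> a *: z = 0) ->
    w <> 0 -> (forall a, a \in m -> a *: w = 0) ->
  exists f : {linear C -> Q}, injective f.
Proof.
move=> Cz mz w0 mw.
have gen c : exists a, a *: z = c.
  have [e] := Cz c.
  by rewrite big_ord_recl big_ord0 addr0 /= => ->; exists (e 0%N).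
have unit_ann (b : R) (D : lmodType R) (y : D) : y <> 0 -> b *: y = 0 -> b \in m.
  move=> y0 by0; apply: contrapT => /negP/(notin_max_unit R_noeth R_local)[e eb].
  by apply: y0; rewrite -[y]scale1r -eb -scalerA by0 scaler0.
have [z0|z0] := pselect (z = 0).
  exists (\0 : {linear C -> Q}) => c c' _.
  by have [a <-] := gen c; have [a' <-] := gen c'; rewrite z0 !scaler0.
have [b|h hE] := factor_surj (g := line_map z) (f := line_map w) gen.
  by rewrite !line_mapE => /(unit_ann _ _ _ z0)/mw.
exists h; apply: linear_inj => c; have [a <-] := gen c.
by rewrite -line_mapE hE !line_mapE => /(unit_ann _ _ _ w0)/mz.
Qed.

Variable d : nat.
Hypothesis R_dim : krull_dim_eq R d.
Hypothesis di : (d <= i)%N.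

(** If Ext^(i+1) (k, R) were nonzero, no module with vanishing Ext^(i+1) would
    contain [k], by right exactness.  Starting from [R], this produces step by
    step an [R]-regular sequence of length [i + 1], since Ext^(j+1) (R / (xs), R)
    vanishes for [j] at least the length of [xs].  Its length exceeds [dim R]. *)
Lemma ext_vanishes_residue (C : lmodType R) (z : C) :
  (forall c, spans [:: z] c) -> (forall a, a \in m -> a *: z = 0) ->
  ext_vanishes I i C.
Proof.
move=> Cz mz; apply: contrapT => nC.
pose Q xs := quotmod (ideal_mul_submod (R^o : lmodType R) xs).
have build t : (t <= i.+1)%N -> exists xs : seq R,
  [/\ size xs = t, {subset xs <= m},
     forall k, (k < size xs)%N -> forall v : R^o,
       ideal_mul (take k xs) (xs`_k *: v) -> ideal_mul (take k xs) v
   & forall j, (t <= j)%N -> ext_vanishes I j (Q xs)].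
  elim: t => [_|t IH ti].
    exists [::]; split=> // j _.
    apply: (ext_vanishes_iso (f := quotmod_proj _)); first exact: quot_nil.
      exact: quotmod_proj_surj.
    exact/ext_vanishes_projective/projective_regular.
  have [xs [xst xsm reg vQ]] := IH (ltnW ti).
  have Qfg : fin_gen (Q xs).
    by apply: fin_gen_surj (fin_gen_regular R); exact: quotmod_proj_surj.
  have [w mw|x xm xreg] := regular_element R_noeth Qfg (I := max_submod R_local).
    apply: contrapT => w0; apply: nC.
    have [f fi] := residue_embedding Cz mz w0 mw.
    by apply: (ext_vanishes_submod fi Qfg); exact: vQ.
  have xreg' (v : R^o) : ideal_mul xs (x *: v) -> ideal_mul xs v.
    move=> xv; apply/(quotmod_proj_eq0 (ideal_mul_submod R^o xs)); apply: xreg.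
    by rewrite -linearZ; apply/quotmod_proj_eq0.
  have [q xq] := quot_rcons xreg'.
  exists (rcons xs x); split.
  - by rewrite size_rcons xst.
  - by move=> y; rewrite mem_rcons inE => /orP[/eqP ->|/xsm].
  - move=> k; rewrite size_rcons ltnS leq_eqVlt => /orP[/eqP ->|kxs] v.
      by rewrite -cats1 take_size_cat // nth_cat ltnn subnn; exact: xreg'.
    by rewrite -cats1 takel_cat ?(ltnW kxs) // nth_cat kxs; exact: reg.
  - case=> // j tj; apply: (ext_vanishes_right xq); apply: vQ => //.
    exact: leqW.
have [xs [xst xsm reg _]] := build i.+1 (leqnn _).
have [p pc _] := regular_seq_chain R_noeth (max_prime R_noeth R_local) reg xsm.
by have := R_dim.2 _ _ pc; rewrite xst ltnNge di.
Qed.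

(** A maximal submodule [T] with vanishing Ext is everything: otherwise it can be
    enlarged by a cyclic module [C] with prime annihilator.  If this prime is not
    [m], an element of [m] is regular on [C] and Nakayama's lemma applies; if it
    is, [C] is the residue field. *)
Lemma ext_vanishes_prev (N : lmodType R) : fin_gen N -> ext_vanishes I i N.
Proof.
move=> Nfg; pose F (T : submodule N) := ext_vanishes I i (submod T).
have F0 : F (spans [::]).
  apply: ext_vanishes_zero => x; apply: submod_val_inj.
  by rewrite linear0; apply/spans_nil; exact: (submod_valP x).
have [T [vT _ Tmax]] := noeth_max R_noeth Nfg F0.
have [Tall|nTall] := pselect (forall v, T v).
  apply: (ext_vanishes_iso (f := submod_val T)) => // v; exact: submod_val_ex.
have [v Tv] : exists v, ~ T v.
  apply: contrapT => h; apply: nTall => v; apply: contrapT => Tv; apply: h.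
  by exists v.
pose Q := quotmod T; have qv : quotmod_proj T v <> 0 by move=> /quotmod_proj_eq0.
have Qfg : fin_gen Q by apply: fin_gen_surj Nfg; exact: quotmod_proj_surj.
have [z zm _] := max_ann_ex R_noeth qv; have [z0 _] := zm.
pose U := preimage_submod (quotmod_proj T) (spans [:: z]).
suff vU : F U.
  have [w wz] := quotmod_proj_surj z.
  case: z0; rewrite -wz; apply/quotmod_proj_eq0/(Tmax U vU).
    move=> u Tu; change (spans [:: z] (quotmod_proj T u)).
    by rewrite (quotmod_proj_eq0 T u).2 //; exact: submodule0.
  change (spans [:: z] (quotmod_proj T w)); rewrite wz.
  by apply: mem_spans; rewrite mem_head.
pose C := submod (spans [:: z]).
have [|f fE] := @submod_corestr _ _ U _ (submod_val T).
  move=> t; change (spans [:: z] (quotmod_proj T (submod_val T t))).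
  by rewrite (quotmod_proj_eq0 T _).2; [exact: submodule0 | exact: submod_valP].
have [|g gE] := @submod_corestr _ _ (spans [:: z]) _ (quotmod_proj T \o submod_val U).
  by move=> u; exact: (submod_valP u).
have fg : short_exact f g.
  split.
  - by move=> s t st; apply: submod_val_inj; rewrite -!fE st.
  - move=> c; have [w wc] := quotmod_proj_surj (submod_val _ c).
    have [|u uw] := @submod_val_ex _ _ U w.
      change (spans [:: z] (quotmod_proj T w)); rewrite wc; exact: submod_valP.
    by exists u; apply: submod_val_inj; rewrite gE -[LHS]/(quotmod_proj T (submod_val U u)) uw.
  - move=> u; split=> [gu|[t <-]].
      have /(submod_val_ex (S := T))[t tu] : T (submod_val U u).
        by apply/quotmod_proj_eq0; rewrite -[LHS]gE gu linear0.
      by exists t; apply: submod_val_inj; rewrite fE.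
    apply: submod_val_inj.
    rewrite gE -[LHS]/(quotmod_proj T (submod_val U (f t))) fE linear0.
    exact/quotmod_proj_eq0/submod_valP.
apply: (ext_vanishes_mid fg) => //.
have [y yz] : exists y : C, submod_val _ y = z.
  by apply: submod_val_ex; apply: mem_spans; rewrite mem_head.
have Cy (c : C) : exists a, c = a *: y.
  have := submod_valP c; case=> e; rewrite big_ord_recl big_ord0 addr0 /= => ce.
  by exists (e 0%N); apply: submod_val_inj; rewrite linearZ yz.
have Cfg : fin_gen C.
  by exists [:: y] => c; have [a ->] := Cy c; exists (fun=> a); rewrite big_ord_recl big_ord0 addr0.
have [mz|nmz] := pselect (forall a, a \in m -> a *: z = 0).
  apply: (ext_vanishes_residue (z := y)).
    move=> c; have [a ->] := Cy c.
    by apply: submoduleZ; apply: mem_spans; rewrite mem_head.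
  by move=> a /mz az; apply: submod_val_inj; rewrite linearZ yz linear0.
have [x xm xz] : exists2 x, x \in m & x *: z <> 0.
  apply: contrapT => h; apply: nmz => a am; apply: contrapT => az; apply: h.
  by exists a.
have xi : injective (scale_map C x).
  apply: linear_inj => c; have [a ->] := Cy c.
  move=> /(congr1 (submod_val _)); rewrite scale_mapE scalerA linearZ yz linear0.
  move=> /(max_ann_prime zm)[//|az]; apply: submod_val_inj.
  by rewrite linearZ yz linear0.
apply: (ext_vanishes_regular R_noeth R_local xm Cfg
  (q := quotmod_proj (image_submod (scale_map C x)))).
  split=> //; first exact: quotmod_proj_surj.
  by move=> b; split=> [/quotmod_proj_eq0//|h]; apply/quotmod_proj_eq0.
by apply: ext_next; apply: fin_gen_surj Cfg; exact: quotmod_proj_surj.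
Qed.

End Step.

(** Bass: the injective dimension of a Noetherian local ring, when finite, is at
    most its Krull dimension.  The induction descends from the degree where the
    injective resolution stops. *)
Lemma ext_vanishes_dim d r :
    krull_dim_eq R d -> (forall i, (r < i)%N -> zero_module (I i)) ->
  forall i (N : lmodType R), (d <= i)%N -> fin_gen N -> ext_vanishes I i N.
Proof.
move=> R_dim I0; have top i N : (r <= i)%N -> ext_vanishes I i N.
  by move=> ri; apply: ext_vanishes_bounded; apply: I0.
move=> i N di Nfg; have [/top //|/ltnW/subnKC] := leqP r i.
move: (r - i)%N => k; elim: k i N di Nfg => [|k IH] i N di Nfg ir.
  by apply: top; rewrite -ir addn0.
apply: (ext_vanishes_prev _ R_dim di) Nfg => N' N'fg.
by apply: IH N'fg _; [exact: leqW | rewrite addSnnS].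
Qed.

(** Climbs down the quotients of [N] by initial segments of the regular sequence,
    gaining one degree at each step. *)
Lemma ext_vanishes_depth d (N : lmodType R) (xs : seq R) i :
    (forall j N', (d <= j)%N -> fin_gen N' -> ext_vanishes I j N') ->
    fin_gen N -> {subset xs <= m} -> regular_seq N xs -> (d <= i + size xs)%N ->
  ext_vanishes I i N.
Proof.
move=> vd Nfg xsm [reg _] dix.
pose Q k := quotmod (ideal_mul_submod N (take k xs)).
have Qfg k : fin_gen (Q k) by apply: fin_gen_surj Nfg; exact: quotmod_proj_surj.
suff vQ l k j : (k + l = size xs)%N -> (d <= j + l)%N -> ext_vanishes I j (Q k).
  have v0 := vQ (size xs) 0%N i erefl dix.
  have qi := @quot_nil N; have qs := quotmod_proj_surj (S := ideal_mul_submod N [::]).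
  rewrite /Q take0 in v0.
  have [|h hE] := factor_inj (f := quotmod_proj (ideal_mul_submod N [::])) (h := idfun) qi.
    by move=> x; exact: qs.
  apply: (ext_vanishes_iso (f := h)) v0; first by apply: can_inj hE.
  by move=> v; exists (quotmod_proj (ideal_mul_submod N [::]) v); apply: qi; rewrite hE.
elim: l k j => [|l IH] k j kl djl; first by apply: vd; [rewrite addn0 in djl|].
have kx : (k < size xs)%N by rewrite -kl -[ltnLHS]addn0 ltn_add2l.
have [q xq] := quot_rcons (reg k kx).
rewrite -(take_nth 0 kx) in q xq.
apply: (ext_vanishes_regular R_noeth R_local _ _ xq).
- by apply: xsm; exact: mem_nth.
- exact: Qfg.
- by apply: IH; [rewrite addSnnS | rewrite addSnnS].
Qed.

End InjectiveDimension.

(** * Projective dimension of syzygies *)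

Section PairMaps.
Variables (R : comNzRingType) (X A B C D : lmodType R).

Definition pair_map (f : {linear X -> A}) (g : {linear X -> B}) :
  {linear X -> (A * B)%type}.
Proof.
apply: (@mk_linear _ _ _ (fun x => (f x, g x))).
by move=> a u v; rewrite !linearP.
Defined.

Definition sum_map (f : {linear A -> C}) (g : {linear B -> C}) :
  {linear (A * B)%type -> C}.
Proof.
apply: (@mk_linear _ _ _ (fun x => f x.1 + g x.2)).
by move=> a u v /=; rewrite !linearP scalerDr addrACA.
Defined.

Definition fst_map : {linear (A * B)%type -> A}.
Proof. exact: (@mk_linear _ _ _ (fun x => x.1)). Defined.

Definition snd_map : {linear (A * B)%type -> B}.
Proof. exact: (@mk_linear _ _ _ (fun x => x.2)). Defined.

End PairMaps.

Section ProjectiveDimension.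
Variable R : comNzRingType.
Implicit Types K L M N P Q E F X : lmodType R.

Lemma projective_retract P L (i : {linear L -> P}) (r : {linear P -> L}) :
  projective_module P -> (forall x, r (i x) = x) -> projective_module L.
Proof.
move=> Pp ri A B g f gs; have [h hE] := Pp A B g (f \o r) gs.
by exists (h \o i) => x; rewrite /= hE /= ri.
Qed.

Lemma projective_pair P Q : projective_module P -> projective_module Q ->
  projective_module (P * Q)%type.
Proof.
move=> Pp Qp A B g f gs.
have [h hE] := Pp A B g (f \o pair_map idfun \0) gs.
have [k kE] := Qp A B g (f \o pair_map \0 idfun) gs.
exists (sum_map h k) => x; rewrite mk_linearE linearD hE kE /= -linearD.
by case: x => x y; congr (f (_, _)); rewrite /= ?addr0 ?add0r.
Qed.

(** Projective dimension at most [k], by recursion on [k] through one projective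
    presentation; [pd_le_kernel] shows that the presentation does not matter. *)
Fixpoint pd_le (k : nat) M : Prop :=
  if k is k'.+1 then
    exists K P (f : {linear K -> P}) (g : {linear P -> M}),
      [/\ projective_module P, short_exact f g & pd_le k' K]
  else projective_module M.

(** Schanuel's lemma, in a form stable under iteration: if [L] is a retract of
    [X + Q] with [Q] projective, the kernel of a projective presentation [E -> L]
    is a retract of [K + E], where [K] is a syzygy of [X]. *)
Lemma schanuel_retract X Q L K F K' E (i : {linear L -> (X * Q)%type})
    (r : {linear (X * Q)%type -> L}) (f : {linear K -> F}) (g : {linear F -> X})
    (f' : {linear K' -> E}) (g' : {linear E -> L}) :
    projective_module F -> projective_module Q -> projective_module E ->
    (forall x, r (i x) = x) -> short_exact f g -> short_exact f' g' ->
  exists (i' : {linear K' -> (K * E)%type}) (r' : {linear (K * E)%type -> K'}),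
    forall x, r' (i' x) = x.
Proof.
move=> Fp Qp Ep ri fg fg'; have [fi gs _] := fg; have [fi' gs' _] := fg'.
pose gQ : {linear (F * Q)%type -> (X * Q)%type} :=
  pair_map (g \o fst_map F Q) (snd_map F Q).
have gQs : onto gQ by move=> [x q]; have [y yx] := gs x; exists (y, q); rewrite -yx.
have [b bE] := Ep _ _ gQ (i \o g') gQs.
have [a aE] := projective_pair Fp Qp (r \o gQ) gs'.
have aE' y : g' (a y) = r (gQ y) by rewrite aE.
have b0 x : gQ (b (f' x)) = 0 by rewrite bE /= (short_exact0 fg') linear0.
have [x|k kE] := factor_inj (h := fst_map F Q \o b \o f') fi.
  have [_ _ ex] := fg; apply/ex.
  by have /(congr1 fst) := b0 x.
pose h : {linear (K * E)%type -> E} :=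
  sum_map (a \o pair_map f \0) (idfun \- (a \o b)).
have [x|l lE] := factor_inj (h := h) fi'.
  have [_ _ ex] := fg'; apply/ex.
  rewrite -[h x]/(a (f x.1, 0) + (x.2 - a (b x.2))) linearD linearB !aE'.
  rewrite bE /= ri subrr addr0.
  by rewrite -[RHS](linear0 r); congr (r (_, _)); rewrite /= (short_exact0 fg).
(* The section is x |-> (k x, f' x), where f (k x) is the first component of
   b (f' x); h is the retraction, (y, e) |-> a (f y, 0) + (e - a (b e)). *)
exists (pair_map k f'), l => x; apply: fi'; rewrite lE mk_linearE /=.
rewrite kE /= addrC -[RHS]addr0 -addrA; congr (_ + _).
rewrite addrC -linearB -[RHS](linear0 a); congr (a _).
have /(congr1 snd)/= b2 := b0 x.
by case: (b (f' x)) b2 => y z /= ->; congr (_, _); rewrite /= subrr.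
Qed.

(** Quantifying over retracts of [X + Q] makes the induction go through, as these
    are what [schanuel_retract] produces for the next syzygy. *)
Lemma pd_le_kernel k X Q L K' E (i : {linear L -> (X * Q)%type})
    (r : {linear (X * Q)%type -> L}) (f' : {linear K' -> E}) (g' : {linear E -> L}) :
    pd_le k.+1 X -> projective_module Q -> projective_module E ->
    (forall x, r (i x) = x) -> short_exact f' g' ->
  pd_le k K'.
Proof.
elim: k X Q L K' E i r f' g' => [|k IH] X Q L K' E i r f' g';
  case=> [K [F [f [g [Fp fg pdK]]]]] Qp Ep ri fg';
  have [i' [r' ri']] := schanuel_retract Fp Qp Ep ri fg fg'.
  exact: projective_retract (projective_pair pdK Ep) ri'.
exists (submod (kernel_submod (free_cover K'))), (free_module R K').
exists (submod_val _), (free_cover K').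
have ex := kernel_short_exact (@free_cover_surj R K').
split=> //; first exact: free_module_projective.
exact: (IH K E K' _ _ i' r' _ _ pdK Ep (@free_module_projective R K') ri' ex).
Qed.

Lemma pd_le_syzygy k M K E (f : {linear K -> E}) (g : {linear E -> M}) :
  pd_le k.+1 M -> projective_module E -> short_exact f g -> pd_le k K.
Proof.
move=> pdM Ep fg; pose Q := ('rV[R]_0 : lmodType R).
apply: (pd_le_kernel (i := pair_map idfun \0) (r := fst_map M Q) pdM _ Ep _ fg) => //.
exact: projective_rV.
Qed.

Lemma pd_le_resolution k M : proj_dim_le M k -> pd_le k M.
Proof.
elim: k M => [|k IH] M [P P0].
  have pi : injective (pres_aug P).
    apply: linear_inj => x /pres_exact0[y <-].
    by rewrite (P0 1%N (ltn0Sn _) y) linear0.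
  have [x|r rE] := factor_inj (h := idfun) pi; first exact: pres_aug_surj.
  exact: projective_retract (@pres_projective _ _ P 0) rE.
pose K := submod (kernel_submod (pres_aug P)).
have ex := kernel_short_exact (@pres_aug_surj _ _ P).
exists K, (P 0%N), (submod_val _), (pres_aug P); split=> //.
  exact: pres_projective.
apply: IH; have [x|a aE] := @submod_corestr _ _ (kernel_submod (pres_aug P)) _ (pres_diff P 0).
  by apply/pres_exact0; exists x.
have as_ : onto a.
  move=> x; have /pres_exact0[y yx] := submod_valP x; exists y.
  by apply: submod_val_inj; rewrite aE.
have a0 : exact (pres_diff P 1) a.
  move=> y; split=> [ay|/pres_exact yx].
    by apply/pres_exact; rewrite -aE ay linear0.
  by apply: submod_val_inj; rewrite aE yx linear0.
exists (@ProjResolution R K (fun i => P i.+1) (fun i => pres_diff P i.+1) a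
  (fun i => @pres_projective _ _ P i.+1) as_ a0 (fun i => @pres_exact _ _ P i.+1)).
by move=> i ki; apply: P0.
Qed.

End ProjectiveDimension.

(** * Ext does not depend on the projective resolution *)

Section ChainMaps.
Variable R : comNzRingType.

(** A chain map from a complex of projectives to an exact complex is
    null-homotopic. *)
Lemma null_homotopy (P A : nat -> lmodType R) (N : lmodType R)
    (dP : forall i, {linear P i.+1 -> P i}) (dA : forall i, {linear A i.+1 -> A i})
    (e : {linear A 0%N -> N}) (u : forall i, {linear P i -> A i}) :
    (forall i, projective_module (P i)) -> (forall i x, dP i (dP i.+1 x) = 0) ->
    exact (dA 0%N) e -> (forall i, exact (dA i.+1) (dA i)) ->
    (forall x, e (u 0%N x) = 0) -> (forall i x, dA i (u i.+1 x) = u i (dP i x)) ->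
  exists s : forall i, {linear P i -> A i.+1},
    (forall x, dA 0%N (s 0%N x) = u 0%N x) /\
    forall i x, dA i.+1 (s i.+1 x) + s i (dP i x) = u i.+1 x.
Proof.
move=> Pp dPP ex0 exS u0 uS.
pose H i (s : {linear P i -> A i.+1}) := forall x, dA i (u i.+1 x - s (dP i x)) = 0.
pose T i := {s : {linear P i -> A i.+1} | H i s}.
have t0 : {s : T 0%N | forall x, dA 0%N (sval s x) = u 0%N x}.
  apply: cid; have [x|s sE] := projective_lift (Pp 0%N) ex0 (h := u 0%N); first exact: u0.
  have Hs : H 0%N s by move=> x; rewrite linearB sE uS subrr.
  by exists (exist _ s Hs).
have tS i (t : T i) : {s : T i.+1 | forall x, dA i.+1 (sval s x) + sval t (dP i x) = u i.+1 x}.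
  case: t => t Ht; apply: cid.
  have [x|s sE] := projective_lift (Pp i.+1) (exS i) (h := u i.+1 \- (t \o dP i)).
    exact: Ht.
  have Hs : H i.+1 s by move=> x; rewrite linearB sE /= uS dPP linear0 subr0 subrr.
  by exists (exist _ s Hs) => x /=; rewrite sE /= subrK.
pose s := nat_rect T (sval t0) (fun i t => sval (tS i t)).
exists (fun i => sval (s i)); split=> [x|i x]; first exact: (svalP t0 x).
exact: (svalP (tS i (s i)) x).
Qed.

Variable M : lmodType R.
Implicit Types P Q : proj_resolution M.

Lemma pres_dd P i x : pres_diff P i (pres_diff P i.+1 x) = 0.
Proof. by apply/pres_exact; exists x. Qed.

Lemma pres_aug_d P x : pres_aug P (pres_diff P 0 x) = 0.
Proof. by apply/pres_exact0; exists x. Qed.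

(** The complex [Q] augmented by [M] in front is exact, and the augmentation of
    [P] is a chain map to it concentrated in one degree.  A null-homotopy of it is,
    up to signs, a chain map from [P] to [Q]. *)
Lemma resolution_map P Q : exists a : forall i, {linear P i -> Q i},
  (forall x, pres_aug Q (a 0%N x) = pres_aug P x) /\
  forall i x, pres_diff Q i (a i.+1 x) = a i (pres_diff P i x).
Proof.
pose A i : lmodType R := if i is j.+1 then Q j else M.
pose dA i : {linear A i.+1 -> A i} :=
  if i is j.+1 then pres_diff Q j else pres_aug Q.
pose u i : {linear P i -> A i} := if i is j.+1 then \0 else pres_aug P.
have [|||||| s [s0 sS]] := @null_homotopy P A M (pres_diff P) dA \0 u.
- exact: pres_projective.
- exact: pres_dd.
- by move=> y; split=> // _; exact: pres_aug_surj.
- by case=> [|i] y; [exact: pres_exact0 | exact: pres_exact].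
- by [].
- by case=> [|i] x /=; rewrite linear0 // pres_aug_d.
exists (fun i => (-1) ^+ i \*: s i); split=> [x|i x] /=.
  by rewrite expr0 scale1r; exact: s0.
have /eqP := sS i x; rewrite addr_eq0 linearZ /= => /eqP ->.
by rewrite exprS mulN1r scaleNr scalerN opprK.
Qed.

Lemma resolution_homotopy P (c : forall i, {linear P i -> P i}) :
    (forall x, pres_aug P (c 0%N x) = pres_aug P x) ->
    (forall i x, pres_diff P i (c i.+1 x) = c i (pres_diff P i x)) ->
  exists s : forall i, {linear P i -> P i.+1},
    (forall x, x = c 0%N x + pres_diff P 0 (s 0%N x)) /\
    forall i x, x = c i.+1 x + (pres_diff P i.+1 (s i.+1 x) + s i (pres_diff P i x)).
Proof.
move=> c0 cS.
have [|||||| s [s0 sS]] := @null_homotopy P P M (pres_diff P) (pres_diff P)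
  (pres_aug P) (fun i => idfun \- c i).
- exact: pres_projective.
- exact: pres_dd.
- exact: pres_exact0.
- by move=> i; exact: pres_exact.
- by move=> x; rewrite /= linearB c0 subrr.
- by move=> i x; rewrite /= linearB cS.
by exists s; split=> [x|i x]; rewrite ?s0 ?sS /= addrC subrK.
Qed.

End ChainMaps.

Section HomologyMaps.
Variable R : comNzRingType.

Definition isomorphic (A B : lmodType R) :=
  exists f : {linear A -> B}, injective f /\ onto f.

Lemma isomorphic_sym A B : isomorphic A B -> isomorphic B A.
Proof.
move=> [f [fi fs]]; have [x|g gE] := factor_inj (h := idfun) fi; first exact: fs.
exists g; split=> [|a]; first exact: can_inj gE.
by exists (f a); apply: fi; rewrite gE.
Qed.

Lemma isomorphic_trans A B C : isomorphic A B -> isomorphic B C -> isomorphic A C.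
Proof.
move=> [f [fi fs]] [g [gi gs]]; exists (g \o f); split; first exact: inj_comp.
by move=> c; have [b <-] := gs c; have [a <-] := fs b; exists a.
Qed.

Section Classes.
Variables (A B C : lmodType R) (f : {linear A -> B}) (g : {linear B -> C}).

Definition cycles_val : {linear ker_module g -> B} := val : ker_module g -> B.

Definition homology_class : {linear ker_module g -> homology f g} :=
  @quot_proj R (ker_module g) (boundary_pred f (g := g)).

Lemma cycles_valP z : g (cycles_val z) = 0.
Proof. exact/eqP/(valP z). Qed.

Lemma cycles_val_inj : injective cycles_val.
Proof. exact: val_inj. Qed.

Lemma cycles_val_ex b : g b = 0 -> exists z, cycles_val z = b.
Proof. by move=> /eqP gb; exists (SubModule (gb : b \in ker_pred g)). Qed.

Lemma homology_class_surj : onto homology_class.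
Proof. by move=> x; have [v ->] := quot_proj_surj x; exists v. Qed.

Lemma homology_class_eq0 z : homology_class z = 0 <-> exists x, f x = cycles_val z.
Proof.
rewrite -[0](linear0 homology_class) quot_projP subr0.
by split=> [/asboolP|h]; last exact/asboolP.
Qed.

Lemma homology_zero : (forall b, g b = 0 -> exists x, f x = b) -> zero_module (homology f g).
Proof.
move=> ex c; have [z <-] := homology_class_surj c.
by apply/homology_class_eq0/ex/cycles_valP.
Qed.

Lemma homology_zero_exact b : zero_module (homology f g) -> g b = 0 -> exists x, f x = b.
Proof. by move=> H0 /cycles_val_ex[z <-]; exact/homology_class_eq0/H0. Qed.

End Classes.

Lemma homology_isomorphic (A B C A' B' C' : lmodType R)
    (f : {linear A -> B}) (g : {linear B -> C})
    (f' : {linear A' -> B'}) (g' : {linear B' -> C'}) (h : {linear B -> B'}) :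
    (forall z, g z = 0 -> g' (h z) = 0) ->
    (forall z, g z = 0 -> (exists x, f x = z) <-> exists x, f' x = h z) ->
    (forall z', g' z' = 0 -> exists z, g z = 0 /\ exists x, f' x = z' - h z) ->
  isomorphic (homology f g) (homology f' g').
Proof.
move=> hg hf hs.
have [z|k kE] := factor_inj (h := h \o cycles_val g) (@cycles_val_inj _ _ g').
  by apply: cycles_val_ex; apply: hg; exact: cycles_valP.
have [z|F FE] := factor_surj (f := homology_class f' g' \o k)
    (homology_class_surj (f := f) (g := g)).
  move=> /homology_class_eq0/(hf _ (cycles_valP z)) fz.
  by apply/homology_class_eq0; rewrite kE.
exists F; split.
  apply: linear_inj => c; have [z <-] := homology_class_surj (f := f) (g := g) c.
  rewrite FE /= => /homology_class_eq0; rewrite kE /= => fz.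
  by apply/homology_class_eq0/(hf _ (cycles_valP z)).
move=> c; have [z' <-] := homology_class_surj (f := f') (g := g') c.
have [z0 [gz0 fz]] := hs _ (cycles_valP z'); have [z zE] := cycles_val_ex gz0.
exists (homology_class f g z); rewrite FE /=; apply/eqP; rewrite eq_sym -subr_eq0 -linearB.
apply/eqP/homology_class_eq0; rewrite linearB.
by have -> : cycles_val g' (k z) = h z0 by rewrite kE -zE.
Qed.

End HomologyMaps.

Section ExtOf.
Variables (R : comNzRingType) (M N : lmodType R).

Definition ext_coboundary (P : proj_resolution M) q (F : Hom_module (P q) N) : Prop :=
  match q return Hom_module (P q) N -> Prop with
  | 0 => fun F => forall x, val F x = 0
  | r.+1 => fun F => exists G : {linear P r -> N}, forall x, val F x = G (pres_diff P r x)
  end F.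

(* Puts the two cases in the definition of Ext_of under one form *)
Lemma Ext_of_homology (P : proj_resolution M) q :
  exists (A : lmodType R) (f : {linear A -> Hom_module (P q) N}),
    Ext_of P q N = homology f (Hom_precomp (N := N) (pres_diff P q)) /\
    forall F, (exists x, f x = F) <-> ext_coboundary F.
Proof.
case: q => [|r].
  exists 'rV[R]_0, \0; split=> // F; split=> [[_ <-] //|F0].
  by exists 0; apply: homP => x; rewrite F0.
exists (Hom_module (P r) N), (Hom_precomp (N := N) (pres_diff P r)); split=> // F.
split=> [[G <-]|[G GE]]; first by exists (lin_of G).
by exists (hom_of G); apply: homP => x; rewrite GE.
Qed.

Lemma ext_cocycle (P : proj_resolution M) q (F : Hom_module (P q) N) :
  Hom_precomp (N := N) (pres_diff P q) F = 0 <->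
  forall x, lin_of F (pres_diff P q x) = 0.
Proof.
split=> [F0 x|F0]; last by apply: homP => x; exact: F0.
by have := congr1 (fun F => val F x) F0.
Qed.

Lemma Ext_of_independent (P Q : proj_resolution M) q :
  isomorphic (Ext_of P q N) (Ext_of Q q N).
Proof.
have [A [f [-> fE]]] := Ext_of_homology P q.
have [A' [f' [-> fE']]] := Ext_of_homology Q q.
have [a [a0 aS]] := resolution_map Q P; have [b [b0 bS]] := resolution_map P Q.
have [|| s [s0 sS]] := resolution_homotopy (c := fun i => a i \o b i).
- by move=> x; rewrite /= a0 b0.
- by move=> i x; rewrite /= aS bS.
have [|| t [t0 tS]] := resolution_homotopy (c := fun i => b i \o a i).
- by move=> x; rewrite /= b0 a0.
- by move=> i x; rewrite /= bS aS.

apply: (homology_isomorphic (h := Hom_precomp (N := N) (a q))).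
- by move=> F /ext_cocycle F0; apply/ext_cocycle => x; rewrite /= -aS; exact: F0.
- move=> F /ext_cocycle F0; rewrite fE fE'.
  case: q F F0 {f fE f' fE'} => [|q] F F0; split=> /=.
  + by move=> F1 x; exact: F1.
  + move=> F1 x; rewrite {1}[x]s0 -lin_ofE linearD F0 addr0; exact: F1.
  + by move=> [G GE]; exists (G \o a q) => x; rewrite /= GE aS.
  + move=> [G GE]; exists ((G \o b q) \+ (lin_of F \o s q)) => x.
    rewrite {1}[x]sS -lin_ofE !linearD F0 add0r; congr (_ + _).
    by rewrite /= -bS; exact: GE.
- move=> F /ext_cocycle F0; exists (Hom_precomp (N := N) (b q) F); split.
    by apply/ext_cocycle => x; rewrite /= -bS; exact: F0.
  rewrite fE'; case: q F F0 {f fE f' fE'} => [|q] F F0 /=.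
    move=> x; rewrite -[LHS]/(lin_of F x - lin_of F (b 0%N (a 0%N x))).
    by rewrite {1}[x]t0 linearD F0 addr0 subrr.
  exists (lin_of F \o t q) => x.
  rewrite -[LHS]/(lin_of F x - lin_of F (b q.+1 (a q.+1 x))).
  by rewrite {1}[x]tS !linearD F0 add0r addrAC subrr add0r.
Qed.

End ExtOf.

(** * Minimal graded free resolutions *)

Section GradedResolution.
Variables (R : comNzRingType) (m : {pred R}).

(** A finite free resolution [0 -> F_p -> ... -> F_0 -> M] packed into one free
    module ['rV_b], the direct sum of the [F_i]: the basis vector [a] lies in
    [F_(gr_deg a)], the differential is one square matrix acting on row vectors,
    and the augmentation is extended by zero.  Minimality says that the entries
    of the differential are in [m]. *)
Record graded_resolution (M : lmodType R) := GradedResolution {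
  gr_rank : nat;
  gr_deg : 'I_gr_rank -> nat;
  gr_diff : 'M[R]_gr_rank;
  gr_aug : {linear 'rV[R]_gr_rank -> M};
  gr_diff_deg : forall a c, gr_deg a != (gr_deg c).+1 -> gr_diff a c = 0;
  gr_aug_deg : forall a, gr_deg a != 0%N -> gr_aug (delta_mx 0 a) = 0;
  gr_aug_surj : onto gr_aug;
  gr_aug_diff : forall v, gr_aug (v *m gr_diff) = 0;
  gr_diff_diff : gr_diff *m gr_diff = 0;
  gr_exact : forall v, v *m gr_diff = 0 -> gr_aug v = 0 -> exists w, v = w *m gr_diff;
  gr_minimal : forall a c, gr_diff a c \in m }.

Lemma mulmx_row_eq b n (A B : 'M[R]_(b, n)) :
  (forall v : 'rV_b, v *m A = v *m B) -> A = B.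
Proof. by move=> AB; apply/row_matrixP => i; rewrite !rowE. Qed.

Section Parts.
Variables (b : nat) (deg : 'I_b -> nat).

Definition homog_part (i : nat) (v : 'rV[R]_b) : 'rV[R]_b :=
  \row_a (if deg a == i then v 0 a else 0).

Lemma homog_part_linear i : linear (homog_part i).
Proof.
move=> c u v; apply/rowP => a; rewrite !mxE.
by case: eqP; rewrite ?mulr0 ?addr0.
Qed.
HB.instance Definition _ i := GRing.isLinear.Build R 'rV[R]_b 'rV[R]_b *:%R
  (homog_part i) (homog_part_linear i).

Definition homog (i : nat) : submodule 'rV[R]_b.
Proof.
exists (fun v : 'rV[R]_b => forall a, deg a != i -> v 0 a = 0).
  by move=> a _; rewrite mxE.
by move=> c u v hu hv a ai; rewrite !mxE hu // hv // mulr0 addr0.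
Defined.

Lemma homog_partP i v : homog i (homog_part i v).
Proof. by move=> a /negbTE ai; rewrite mxE ai. Qed.

Lemma homog_part_id i v : homog i v -> homog_part i v = v.
Proof. by move=> hv; apply/rowP => a; rewrite mxE; case: eqVneq => // /hv ->. Qed.

Lemma homog_delta a : homog (deg a) (delta_mx 0 a).
Proof. by move=> c; rewrite mxE eqxx /=; case: (c =P a) => [->|] //; rewrite eqxx. Qed.

Lemma homog_part_diff (D : 'M[R]_b) i v :
  (forall a c, deg a != (deg c).+1 -> D a c = 0) ->
  homog_part i.+1 v *m D = homog_part i (v *m D).
Proof.
move=> Ddeg; apply/rowP => c; rewrite !mxE; case: eqP => [<-|ci].
  apply: eq_bigr => a _; rewrite !mxE; case: eqVneq => // /Ddeg ->.
  by rewrite !mulr0.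
apply: big1 => a _; rewrite mxE; case: eqP => [ai|_]; last by rewrite mul0r.
by rewrite Ddeg ?mulr0 // ai eqSS eq_sym; apply/eqP.
Qed.

Lemma homog0_diff (D : 'M[R]_b) v :
  (forall a c, deg a != (deg c).+1 -> D a c = 0) ->
  homog 0 v -> v *m D = 0.
Proof.
move=> Ddeg hv; apply/rowP => c; rewrite !mxE; apply: big1 => a _.
by have [a0|/hv ->] := eqVneq (deg a) 0%N; [rewrite Ddeg ?mulr0 ?a0 | rewrite mul0r].
Qed.

Lemma aug_homog0 (M : lmodType R) (aug : {linear 'rV[R]_b -> M}) v :
  (forall a, deg a != 0%N -> aug (delta_mx 0 a) = 0) ->
  aug (homog_part 0 v) = aug v.
Proof.
move=> adeg; rewrite [v in RHS]row_sum_delta [homog_part _ _]row_sum_delta !linear_sum.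
apply: eq_bigr => a _; rewrite !linearZ mxE /=.
by case: eqVneq => // /adeg ->; rewrite !scaler0.
Qed.

End Parts.

Hypothesis R_noeth : noetherian R.
Hypothesis R_local : local_ring m.

(** The kernel of [p] is a direct summand contained in [m] times the free module,
    so Nakayama's lemma applies to it. *)
Lemma projective_minimal_cover (M : lmodType R) n (p : {linear 'rV[R]_n -> M}) :
  projective_module M -> onto p -> (forall v, p v = 0 -> forall i, v 0 i \in m) ->
  forall v, p v = 0 -> v = 0.
Proof.
move=> Mp ps pm; have [s sE] := Mp _ _ p idfun ps.
pose r : {linear 'rV[R]_n -> 'rV[R]_n} := idfun \- (s \o p).
have rK v : p v = 0 -> r v = v by move=> pv; rewrite /= pv linear0 subr0.
have pr v : p (r v) = 0 by rewrite /= linearB sE subrr.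
have @Z0 : submodule 'rV[R]_n by exists (fun v => v = 0) => // a u v -> ->; rewrite scaler0 addr0.
suff ker0 z : kernel_submod p z -> Z0 z by exact: ker0.
move: z; apply: (nakayama R_noeth R_local (s := map r (delta_basis R n))).
- by move=> _ /mapP[v _ ->]; exact: pr.
- move=> z pz; exists 0 => //; rewrite subr0 -[z]rK //.
  by apply: spans_linear; exact: delta_basisP.
- move=> z pz T _ mT; rewrite -[z]rK // {1}[z]row_sum_delta linear_sum.
  apply: submodule_sum => i _; rewrite linearZ; apply: mT; last exact: pr.
  exact: pm.
Qed.

(** Splices a minimal cover ['rV_n -> M] with a graded resolution of its kernel
    [K], which is shifted by one degree; the new block [A] of the differential is
    the augmentation onto [K], and its entries are in [m] by minimality. *)
Lemma graded_resolution_ex k (M : lmodType R) :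
  pd_le k M -> fin_gen M -> exists G : graded_resolution M, True.
Proof.
elim: k M => [|k IH] M pdM Mfg; have [n [p [ps pm]]] := minimal_cover R_noeth R_local Mfg.
  have p0 := projective_minimal_cover pdM ps pm.

  unshelve eexists (@GradedResolution M n (fun=> 0%N) 0 p _ _ ps _ _ _ _) => //.
  - by move=> a c _; rewrite mxE.
  - by move=> v; rewrite mulmx0 linear0.
  - by rewrite mulmx0.
  - by move=> v _ /p0 ->; exists 0; rewrite mul0mx.
  - by move=> a c; rewrite mxE; exact: (submodule0 (max_submod R_local)).
pose K := submod (kernel_submod p); have Kp := kernel_short_exact ps.
have [Ki _ _] := Kp.
have Kfg : fin_gen K by apply: (fin_gen_inj R_noeth Ki); exact: fin_gen_rV.
have [[b deg D aug Ddeg adeg augs augD DD ex Dm] _] :=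
  IH K (pd_le_syzygy pdM (@projective_rV R n) Kp) Kfg.
pose A : 'M[R]_(b, n) := \matrix_i submod_val _ (aug (delta_mx 0 i)).
have AE v : v *m A = submod_val _ (aug v).
  rewrite {2}[v]row_sum_delta !linear_sum mulmx_sum_row; apply: eq_bigr => i _.
  by rewrite rowK !linearZ.
pose deg' (a : 'I_(n + b)) := if fintype.split a is inr j then (deg j).+1 else 0%N.
have degl i : deg' (lshift b i) = 0%N by rewrite /deg' (unsplitK (inl i)).
have degr j : deg' (rshift n j) = (deg j).+1 by rewrite /deg' (unsplitK (inr j)).
pose D' : 'M[R]_(n + b) := block_mx 0 0 A D.
have D'E v : v *m D' = row_mx (rsubmx v *m A) (rsubmx v *m D).
  by rewrite -{1}[v]hsubmxK mul_row_block !mulmx0 !add0r.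
have DA : D *m A = 0.
  by apply: mulmx_row_eq => v; rewrite mulmxA AE augD linear0 mulmx0.
have lsub_lin : linear (@lsubmx R 1 n b) by move=> c u v; rewrite linearP.
unshelve eexists (@GradedResolution M (n + b) deg' D' (p \o mk_linear lsub_lin)
  _ _ _ _ _ _ _) => //.
- move=> a c; case: (split_ordP a) => i ->.
    rewrite !mxE (unsplitK (inl i)) mxE.
    by case: fintype.split => j; rewrite mxE.
  case: (split_ordP c) => j ->; rewrite ?degl ?degr eqSS => ne.
    rewrite block_mxEdl mxE adeg; first by rewrite linear0 mxE.
    exact: ne.
  by rewrite block_mxEdr Ddeg.
- move=> a; case: (split_ordP a) => j ->; rewrite ?degl // => _ /=.
  rewrite -[RHS](linear0 p); congr (p _); apply/rowP => i; rewrite !mxE /=.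
  by rewrite eq_lrshift.
- move=> y; have [v <-] := ps y; exists (row_mx v 0) => /=.
  by rewrite row_mxKl.
- by move=> v /=; rewrite D'E row_mxKl AE; exact: (submod_valP (aug (rsubmx v))).
- by rewrite mulmx_block !(mul0mx, mulmx0, addr0, add0r) DA DD block_mx_const.
- move=> v; rewrite D'E /= => /eqP; rewrite row_mx_eq0 => /andP[/eqP v2A /eqP v2D] pv.
  have [|w2 w2E] := ex (rsubmx v) v2D.
    by apply: submod_val_inj; rewrite -AE v2A linear0.
  have [kap kapE] := @submod_val_ex _ _ (kernel_submod p) (lsubmx v) pv.
  have [w1 w1E] := augs kap.
  (* w2 may be changed in degree 0, where aug must see w1 and D vanishes *)
  pose w := homog_part deg 0 w1 + (w2 - homog_part deg 0 w2).
  have w0 u : homog_part deg 0 u *m D = 0.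
    by apply: homog0_diff Ddeg _; exact: homog_partP.
  exists (row_mx 0 w); rewrite D'E row_mxKr -[LHS]hsubmxK; congr row_mx.
    by rewrite AE linearD linearB !aug_homog0 // subrr addr0 w1E kapE.
  by rewrite mulmxDl mulmxBl !w0 add0r subr0.
- move=> a c; rewrite /D'; case: (split_ordP a) => i ->; case: (split_ordP c) => j ->.
  + by rewrite block_mxEul mxE; exact: (submodule0 (max_submod R_local)).
  + by rewrite block_mxEur mxE; exact: (submodule0 (max_submod R_local)).
  + by rewrite block_mxEdl mxE; apply: pm; exact: (submod_valP (aug _)).
  + by rewrite block_mxEdr.
Qed.

End GradedResolution.

Arguments homog {R b} deg i.

Section GradedToResolution.
Variables (R : comNzRingType) (m : {pred R}) (M : lmodType R).
Variable G : graded_resolution m M.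

Local Notation D := (gr_diff G).
Local Notation deg := (@gr_deg R m M G).
Local Notation aug := (gr_aug G).

Lemma gr_homog_diff i v : homog deg i.+1 v -> homog deg i (v *m D).
Proof.
move=> hv; rewrite -(homog_part_id hv) homog_part_diff; first exact: homog_partP.
exact: gr_diff_deg.
Qed.

Lemma gr_homog0_diff v : homog deg 0 v -> v *m D = 0.
Proof. by apply: homog0_diff; exact: gr_diff_deg. Qed.

Lemma gr_exact_homog i v : homog deg i v -> v *m D = 0 -> aug v = 0 ->
  exists2 w, homog deg i.+1 w & v = w *m D.
Proof.
move=> hv vD av; have [w wE] := gr_exact vD av.
exists (homog_part deg i.+1 w); first exact: homog_partP.
rewrite homog_part_diff; last exact: gr_diff_deg.
by rewrite -wE homog_part_id.
Qed.

Lemma gr_aug_homog i v : i != 0%N -> homog deg i v -> aug v = 0.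
Proof.
move=> i0 hv; rewrite [v]row_sum_delta linear_sum big1 // => a _; rewrite linearZ /=.
have [ai|ai] := eqVneq (deg a) i; last by rewrite hv // scale0r.
by rewrite gr_aug_deg ?scaler0 // ai.
Qed.

Definition gr_obj (i : nat) : lmodType R := submod (homog deg i).

Lemma gr_obj_proj i : {pr : {linear 'rV[R]_(gr_rank G) -> gr_obj i} |
  forall v, submod_val _ (pr v) = homog_part deg i v}.
Proof.
apply: cid; apply: (@submod_corestr _ _ (homog deg i) _ (homog_part deg i)).
by move=> v; exact: homog_partP.
Qed.

Lemma gr_obj_projective i : projective_module (gr_obj i).
Proof.
have [pr prE] := gr_obj_proj i.
apply: (projective_retract (i := submod_val _) (r := pr) (@projective_rV R _)) => x.
by apply: submod_val_inj; rewrite prE homog_part_id //; exact: submod_valP.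
Qed.

Lemma gr_obj_diff i : {d : {linear gr_obj i.+1 -> gr_obj i} |
  forall v, submod_val _ (d v) = submod_val _ v *m D}.
Proof.
apply: cid.
apply: (@submod_corestr _ _ (homog deg i) _ (mulmxr D \o submod_val (homog deg i.+1))).
by move=> v; apply: gr_homog_diff; exact: submod_valP.
Qed.

Definition gr_resolution : proj_resolution M.
Proof.
apply: (@ProjResolution _ M gr_obj (fun i => sval (gr_obj_diff i)) (aug \o submod_val _)).
- exact: gr_obj_projective.
- move=> y; have [v <-] := gr_aug_surj G y; have [pr prE] := gr_obj_proj 0.
  by exists (pr v); rewrite -[LHS]/(aug (submod_val _ (pr v))) prE aug_homog0 //; exact: gr_aug_deg.
- move=> v; split=> [av|[w <-]].
    have [|w hw wE] := @gr_exact_homog 0 _ (submod_valP v) _ av.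
      exact: gr_homog0_diff (submod_valP v).
    have [x xE] := submod_val_ex hw; exists x; apply: submod_val_inj.
    by rewrite (svalP (gr_obj_diff 0)) xE.
  rewrite -[LHS]/(aug (submod_val _ (sval (gr_obj_diff 0) w))).
  by rewrite (svalP (gr_obj_diff 0)) gr_aug_diff.
- move=> i v; split=> [dv|[w <-]]; last first.
    apply: submod_val_inj; rewrite !(svalP (gr_obj_diff _)) -mulmxA gr_diff_diff.
    by rewrite mulmx0 linear0.
  have [||w hw wE] := gr_exact_homog (submod_valP v).
  - by rewrite -(svalP (gr_obj_diff _)) dv linear0.
  - exact: gr_aug_homog (submod_valP v).
  have [x xE] := submod_val_ex hw; exists x; apply: submod_val_inj.
  by rewrite (svalP (gr_obj_diff _)) xE.
Defined.

Lemma gr_resolution_diffE i (v : gr_resolution i.+1) :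
  submod_val (homog deg i) (pres_diff gr_resolution i v) =
  submod_val (homog deg i.+1) v *m D.
Proof. exact: (svalP (gr_obj_diff i)). Qed.

Lemma gr_proj_dim k : (forall a, (deg a <= k)%N) -> proj_dim_le M k.
Proof.
move=> degk; exists gr_resolution => i ki v; apply: (@submod_val_inj _ _ (homog deg i)).
rewrite linear0; apply/rowP => a; rewrite mxE; apply: (submod_valP v).
by rewrite neq_ltn (leq_ltn_trans (degk a) ki).
Qed.

End GradedToResolution.

(** * Duality for complexes of free modules *)

Section UniversalCoefficients.
Variables (R : comNzRingType) (W : lmodType R) (I : inj_resolution W).
Variables (X : nat -> lmodType R) (d : forall k, {linear X k -> X k.+1}).
Hypothesis X_proj : forall k, projective_module (X k).
Hypothesis dd0 : forall k x, d k.+1 (d k x) = 0.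

Definition coker k : lmodType R := quotmod (image_submod (d k)).

(** The spectral sequence Ext^i (H^j, W) => H^(i-j) (Hom (X, W)) one step at a
    time: the cokernel of [d s] is an extension of the image of [d s.+1] by the
    cohomology, and Ext of this image is Ext of the next cokernel, shifted. *)
Lemma ext_vanishes_coker K i s :
    (forall k, (K <= k)%N -> zero_module (X k)) ->
    (forall u, ext_vanishes I (i + u) (homology (d (s + u)) (d (s + u).+1))) ->
  ext_vanishes I i (coker s).
Proof.
move=> XK; have [l sl] : exists l, (K <= s + l)%N by exists K; rewrite leq_addl.
elim: l s i sl => [|l IH] s i sl vH.
  apply: ext_vanishes_zero => c; have [x <-] := quotmod_proj_surj c.
  by rewrite (XK s.+1 _ x) ?linear0 //; rewrite addn0 in sl; exact: leqW.
have vC : ext_vanishes I i.+1 (coker s.+1).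
  apply: IH => [|u]; first by rewrite addSnnS.
  have := vH u.+1; rewrite !addnS -!addSn; exact.
pose B := image_submod (d s.+1).
have vB : ext_vanishes I i (submod B).
  apply: (ext_vanishes_left (quotmod_short_exact B) vC).
  exact: ext_vanishes_projective.
have [|q qE] := @submod_corestr _ _ B _ (d s.+1); first by move=> x; exists x.
have [x|g gE] := factor_surj (f := q) (quotmod_proj_surj (S := image_submod (d s))).
  move=> /quotmod_proj_eq0[y <-]; apply: submod_val_inj.
  by rewrite qE dd0 linear0.
have [z|f fE] := factor_surj (g := homology_class (d s) (d s.+1))
    (f := quotmod_proj (image_submod (d s)) \o cycles_val (d s.+1))
    (@homology_class_surj _ _ _ _ _ _).
  by move=> /homology_class_eq0 h; apply/quotmod_proj_eq0.
have fg : short_exact f g.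
  split.
  - apply: linear_inj => c; have [z <-] := homology_class_surj (f := d s) (g := d s.+1) c.
    by rewrite fE => /quotmod_proj_eq0 h; apply/homology_class_eq0.
  - move=> b; have [x xE] := submod_valP b; exists (quotmod_proj _ x).
    by apply: submod_val_inj; rewrite gE qE.
  - move=> c; have [x <-] := quotmod_proj_surj c; split=> [|[h]].
      rewrite gE => /(congr1 (submod_val B)); rewrite qE linear0.
      move=> /cycles_val_ex[z zE]; exists (homology_class _ _ z).
      by rewrite fE -zE.
    have [z <-] := homology_class_surj (f := d s) (g := d s.+1) h.
    rewrite fE => <-; apply: submod_val_inj.
    apply: etrans (congr1 (submod_val B) (gE _)) _; rewrite qE linear0.
    exact: cycles_valP.
by apply: (ext_vanishes_mid fg) => //; have := vH 0%N; rewrite !addn0.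
Qed.

Lemma ext_vanishes_extend s (f : {linear X s -> W}) :
    ext_vanishes I 0 (coker s) -> (forall x, d s x = 0 -> f x = 0) ->
  exists g : {linear X s.+1 -> W}, forall x, g (d s x) = f x.
Proof.
move=> vC fd; pose B := image_submod (d s).
have [|q qE] := @submod_corestr _ _ B _ (d s); first by move=> x; exists x.
have qs : onto q.
  move=> b; have [x xE] := submod_valP b; exists x.
  by apply: submod_val_inj; rewrite qE.
have [x|fb fbE] := factor_surj (f := f) qs.
  by move=> /(congr1 (submod_val B)); rewrite qE linear0 => /fd.
have ex := quotmod_short_exact B; have [Bi Cs _] := ex.
have [g gE] := ires_extend (ires_aug I \o fb) Bi.
have [b|k kE] := short_exact_factor ex (g := ires_diff I 0 \o g).
  by rewrite /= gE; apply/ires_exact0; exists (fb b).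
have [c|h hE] := vC k; first by have [x <-] := Cs c; rewrite kE /= ires_dd.
have [y|l lE] := factor_inj (h := g \- (h \o quotmod_proj B)) (@ires_aug_inj _ _ I).
  have /ires_exact0[w wE] : ires_diff I 0 ((g \- (h \o quotmod_proj B)) y) = 0.
    by rewrite /= linearB hE kE subrr.
  by exists w.
exists l => x; apply: (@ires_aug_inj _ _ I).
by rewrite lE /= -qE (short_exact0 ex) linear0 subr0 gE /= fbE.
Qed.

End UniversalCoefficients.

(** * The endomorphism complex of a graded free resolution *)

Section EndomorphismComplex.
Variables (R : comNzRingType) (m : {pred R}) (M : lmodType R).
Variable G : graded_resolution m M.

Local Notation b := (gr_rank G).
Local Notation D := (gr_diff G).
Local Notation deg := (@gr_deg R m M G).
Local Notation aug := (gr_aug G).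

(** The endomorphisms of degree [j - i], which lower by [j - i] the degree in [F];
    degrees are differences of natural numbers. *)
Definition hom_mx (i j : nat) : submodule 'M[R]_b.
Proof.
exists (fun f : 'M[R]_b => forall a c, (deg a + i != deg c + j)%N -> f a c = 0).
  by move=> a c _; rewrite mxE.
by move=> x f g hf hg a c ac; rewrite !mxE hf // hg // mulr0 addr0.
Defined.

Lemma hom_mx_shift i j i' j' f : (i + j' = i' + j)%N -> hom_mx i j f -> hom_mx i' j' f.
Proof. by move=> e hf a c ac; apply: hf; lia. Qed.

Lemma hom_mxM i j i' j' f g :
  hom_mx i j f -> hom_mx i' j' g -> hom_mx (i + i') (j + j') (f *m g).
Proof.
move=> hf hg a c ac; rewrite mxE big1 // => e _.
have [ae|/hf ->] := eqVneq (deg a + i)%N (deg e + j)%N; last by rewrite mul0r.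
by rewrite hg ?mulr0 //; lia.
Qed.

Definition sign_mx : 'M[R]_b := diag_mx (\row_a (-1) ^+ deg a).
Local Notation E := sign_mx.

Lemma sign_mxM n (f : 'M_(b, n)) a c : (E *m f) a c = (-1) ^+ deg a * f a c.
Proof. by rewrite mul_diag_mx !mxE. Qed.

Lemma mul_sign_mx n (f : 'M_(n, b)) a c : (f *m E) a c = f a c * (-1) ^+ deg c.
Proof. by rewrite mul_mx_diag !mxE. Qed.

Lemma sign_mx_sqr : E *m E = 1%:M.
Proof.
apply/matrixP => a c; rewrite sign_mxM !mxE.
case: eqP => [->|_]; last by rewrite mulr0n mulr0.
by rewrite mulr1n -expr2 sqrr_sign.
Qed.

Lemma sign_diff : E *m D = - (D *m E).
Proof.
apply/matrixP => a c; rewrite sign_mxM [RHS]mxE mul_sign_mx.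
have [ac|ac] := eqVneq (deg a) (deg c).+1.
  by rewrite ac exprS mulN1r mulNr mulrC.
by rewrite gr_diff_deg // mulr0 mul0r oppr0.
Qed.

Lemma hom_mx_diff : hom_mx 0 1 D.
Proof. by move=> a c ac; apply: gr_diff_deg; lia. Qed.

Lemma hom_mx_sign : hom_mx 0 0 E.
Proof.
move=> a c ac; rewrite !mxE; case: eqP => [ac'|]; last by rewrite mulr0n.
by rewrite ac' eqxx in ac.
Qed.

(** The differential f |-> D f - (-1)^|f| f D of the complex Hom (F, F), written
    without reference to the degree |f|: E f E is (-1)^|f| f and E D E is - D. *)
Definition end_diff (f : 'M[R]_b) : 'M[R]_b := D *m f + E *m f *m D *m E.

Lemma end_diff_linear : linear end_diff.
Proof.
move=> x f g; rewrite /end_diff !mulmxDr !mulmxDl -!scalemxAr -!scalemxAl.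
by rewrite scalerDr addrACA.
Qed.
HB.instance Definition _ :=
  GRing.isLinear.Build R 'M[R]_b 'M[R]_b *:%R end_diff end_diff_linear.

Lemma end_diff0 : end_diff 0 = 0. Proof. exact: linear0. Qed.
Lemma end_diffD f g : end_diff (f + g) = end_diff f + end_diff g.
Proof. exact: linearD. Qed.
Lemma end_diffB f g : end_diff (f - g) = end_diff f - end_diff g.
Proof. exact: linearB. Qed.

Lemma hom_mx_end_diff i j f : hom_mx i j f -> hom_mx i j.+1 (end_diff f).
Proof.
move=> hf; apply: submoduleD.
  exact: hom_mx_shift (hom_mxM hom_mx_diff hf).
apply: hom_mx_shift (hom_mxM (hom_mxM (hom_mxM hom_mx_sign hf) hom_mx_diff) hom_mx_sign).
by lia.
Qed.

Lemma mulmx_signK n (f : 'M_(n, b)) : f *m E *m E = f.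
Proof. by rewrite -mulmxA sign_mx_sqr mulmx1. Qed.

Lemma mulmx_diffK n (f : 'M_(n, b)) : f *m D *m D = 0.
Proof. by rewrite -mulmxA gr_diff_diff mulmx0. Qed.

Lemma mulmx_sign_diff n (f : 'M_(n, b)) : f *m E *m D = - (f *m D *m E).
Proof. by rewrite -mulmxA sign_diff mulmxN mulmxA. Qed.

Lemma end_diffK f : end_diff (end_diff f) = 0.
Proof.
rewrite /end_diff !mulmxDr !mulmxDl !mulmxA gr_diff_diff mul0mx add0r.
rewrite sign_mx_sqr mul1mx sign_diff !mulNmx addrA addrN add0r.
by rewrite mulmx_sign_diff mulNmx mulmx_diffK !mul0mx oppr0.
Qed.

Lemma end_diff_conj f : end_diff (E *m f *m E) = - (E *m end_diff f *m E).
Proof.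
rewrite /end_diff mulmxDr mulmxDl !mulmxA sign_mx_sqr mul1mx mulmx_signK.
rewrite mulmx_sign_diff mulNmx mulmx_signK sign_diff !mulNmx opprD opprK.
by [].
Qed.

(** The supertrace pairing makes the endomorphism complex self-dual: cyclicity of
    the trace moves [D] from [f] to [w], and [E] absorbs the signs. *)
Lemma supertrace_end_diff w f :
  \tr (E *m w *m end_diff f) = - \tr (E *m end_diff (E *m w *m E) *m f).
Proof.
have -> : E *m end_diff (E *m w *m E) = - (E *m w *m D + D *m w *m E).
  rewrite end_diff_conj mulmxN !mulmxA sign_mx_sqr mul1mx /end_diff mulmxDl.
  by rewrite mulmx_signK addrC.
rewrite mulNmx linearN opprK /end_diff mulmxDr mulmxDl !linearD /= !mulmxA.
congr (_ + _); rewrite mxtrace_mulC !mulmxA sign_mx_sqr mul1mx.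
by rewrite mxtrace_mulC !mulmxA.
Qed.

Lemma aug_sign v : aug (v *m E) = aug v.
Proof.
rewrite -[LHS](aug_homog0 (deg := deg)); last exact: gr_aug_deg.
rewrite -[RHS](aug_homog0 (deg := deg)); last exact: gr_aug_deg.
congr (aug _); apply/rowP => a; rewrite mxE [RHS]mxE mul_sign_mx.
by case: eqP => // ->; rewrite expr0 mulr1.
Qed.

(** As [aug] kills boundaries and only sees degree 0, where [E] is the identity,
    [f |-> (v |-> aug (v f))] is a morphism of complexes from Hom (F, F) to
    Hom (F, M). *)
Lemma aug_end_diff v f : aug (v *m end_diff f) = aug (v *m D *m f).
Proof.
rewrite /end_diff mulmxDr linearD /= !mulmxA aug_sign gr_aug_diff addr0.
by [].
Qed.

Lemma row_diff_mul r (h : 'M[R]_b) a : (forall e, (deg e < r)%N -> row e h = 0) ->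
  (deg a <= r)%N -> row a (D *m h) = 0.
Proof.
move=> hr ar; rewrite row_mul mulmx_sum_row big1 // => e _; rewrite mxE.
have [ae|ae] := eqVneq (deg a) (deg e).+1; last by rewrite gr_diff_deg // scale0r.
by rewrite hr ?scaler0 //; lia.
Qed.

Variable N : nat.
Hypothesis deg_le : forall a : 'I_b, (deg a <= N)%N.

(** Here [f] has degree [k - N].  Exactness of the resolution solves
    [end_diff g = f] one row degree at a time; only rows landing in degree 0 have
    an obstruction, their augmentation. *)
Lemma end_diff_solve k r f :
    (k <= r + N)%N -> hom_mx N.+1 k.+1 f -> end_diff f = 0 ->
    (forall a, (deg a < r)%N -> row a f = 0) ->
    ((r + N = k)%N -> forall a, deg a = r -> aug (row a f) = 0) ->
  exists g, [/\ hom_mx N.+1 k g, end_diff g = f &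
    forall a, (deg a < r)%N -> row a g = 0].
Proof.
have [l rl] : exists l, (N < r + l)%N by exists N.+1; lia.
elim: l r f rl => [|l IH] r f rl kr hf df f0 fa.
  exists 0; split; [exact: submodule0 | rewrite end_diff0 | by move=> a _; rewrite linear0].
  apply/row_matrixP => a; rewrite f0 ?linear0 //; have := deg_le a; lia.
have rowS h a : row a (E *m h) = (-1) ^+ deg a *: row a h.
  by apply/rowP => c; rewrite mxE sign_mxM !mxE.
have wP a : exists w : 'rV_b, deg a = r ->
    homog deg (r + N.+1 - k) w /\ row a f = w *m D.
  have [ar|] := eqVneq (deg a) r; last by move=> ar; exists 0 => e; rewrite e eqxx in ar.
  have hfa : homog deg (r + N - k) (row a f).
    by move=> c ck; rewrite mxE hf //; lia.
  have [||w hw wE] := gr_exact_homog hfa.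
  - rewrite -row_mul; have -> : f *m D = - (E *m (D *m f) *m E).
      have := congr1 (fun h => E *m h *m E) df.
      rewrite /end_diff mulmxDr mulmxDl mulmx0 mul0mx !mulmxA sign_mx_sqr mul1mx.
      by rewrite mulmx_signK addrC => /eqP; rewrite addr_eq0 => /eqP.
    rewrite linearN /= row_mul rowS (row_diff_mul f0) ?ar //.
    by rewrite scaler0 mul0mx oppr0.
  - have [rk|rk] := eqVneq (r + N)%N k; first exact: fa.
    by apply: gr_aug_homog hfa; lia.
  by exists w => _; split=> //; rewrite addnS subSn.
pose w a := sval (cid (wP a)).
have wE a : deg a = r -> homog deg (r + N.+1 - k) (w a) /\ row a f = w a *m D.
  by rewrite /w; case: cid.
pose g0 : 'M[R]_b := \matrix_a (if deg a == r then w a else 0).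
(* The signs turn E g D E into g0 D, while D g only touches rows of degree > r *)
pose g := - (E *m g0 *m E).
have g0E a : row a g0 = if deg a == r then w a else 0 by rewrite rowK.
have hg0 : hom_mx N.+1 k g0.
  move=> a c ac; have := congr1 (fun v : 'rV_b => v 0 c) (g0E a); rewrite mxE => ->.
  case: eqVneq => [ar|_]; last by rewrite mxE.
  by have [hw _] := wE a ar; rewrite hw //; lia.
have hg : hom_mx N.+1 k g.
  rewrite /g -scaleN1r; apply: submoduleZ.
  by apply: hom_mx_shift (hom_mxM (hom_mxM hom_mx_sign hg0) hom_mx_sign); lia.
have gr a : (deg a < r)%N -> row a g = 0.
  move=> ar; rewrite /g linearN /= row_mul rowS g0E.
  by case: eqVneq => [are|_]; [lia | rewrite scaler0 mul0mx oppr0].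
have dg : end_diff g = D *m g + g0 *m D.
  congr (_ + _); rewrite /g mulmxN !mulNmx !mulmxA sign_mx_sqr mul1mx.
  by rewrite mulmx_sign_diff mulNmx opprK mulmx_signK.
have [||||a|rk a|g2 [hg2 dg2 g2r]] := IH r.+1 (f - end_diff g).
- by rewrite addSnnS.
- by rewrite addSn leqW.
- by apply: submoduleB => //; exact: hom_mx_end_diff.
- by rewrite end_diffB df end_diffK subrr.
- rewrite ltnS leq_eqVlt => /orP[/eqP ar|ar].
    have [_ fw] := wE a ar.
    rewrite linearB dg linearD /= (row_diff_mul gr) ?ar // add0r.
    by rewrite row_mul g0E ar eqxx fw subrr.
  rewrite linearB dg linearD /= f0 // (row_diff_mul gr (ltnW ar)) row_mul g0E.
  by case: eqVneq => [are|_]; [lia | rewrite mul0mx addr0 subrr].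
- by lia.
exists (g + g2); split; first exact: submoduleD.
  by rewrite end_diffD dg2 addrC subrK.
by move=> a ar; rewrite linearD /= gr // g2r ?addr0 // leqW.
Qed.

Lemma homog_row f r a :
  hom_mx N.+1 (N + r).+1 f -> deg a = r -> homog deg 0 (row a f).
Proof. by move=> hf ar c c0; rewrite mxE hf //; lia. Qed.


Lemma lift_rows r (h : {linear 'rV[R]_b -> M}) :
  exists f, [/\ hom_mx N.+1 (N + r).+1 f, forall a, deg a != r -> row a f = 0 &
    forall v, homog deg r v -> aug (v *m f) = h v].
Proof.
have wP a : exists w, homog deg 0 w /\ aug w = h (delta_mx 0 a).
  have [w wE] := gr_aug_surj G (h (delta_mx 0 a)).
  exists (homog_part deg 0 w); split; first exact: homog_partP.
  by rewrite aug_homog0 //; exact: gr_aug_deg.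
pose w a := sval (cid (wP a)).
have wE a : homog deg 0 (w a) /\ aug (w a) = h (delta_mx 0 a) by rewrite /w; case: cid.
pose f : 'M[R]_b := \matrix_a (if deg a == r then w a else 0).
have fE a : row a f = if deg a == r then w a else 0 by rewrite rowK.
exists f; split.
- move=> a c ac; have := congr1 (fun v : 'rV_b => v 0 c) (fE a); rewrite mxE => ->.
  case: eqVneq => [ar|_]; last by rewrite mxE.
  by have [hw _] := wE a; rewrite hw //; lia.
- by move=> a /negbTE ar; rewrite fE ar.
- move=> v hv; rewrite mulmx_sum_row {2}[v]row_sum_delta !linear_sum.
  apply: eq_bigr => a _; rewrite !linearZ /= fE.
  by have [_|/hv ->] := eqVneq (deg a) r; [rewrite (wE a).2 | rewrite !scale0r].
Qed.

Definition end_obj k : lmodType R := submod (hom_mx N.+1 k).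

Lemma end_obj_diff k : {d : {linear end_obj k -> end_obj k.+1} |
  forall f, submod_val _ (d f) = end_diff (submod_val _ f)}.
Proof.
apply: cid.
apply: (@submod_corestr _ _ (hom_mx N.+1 k.+1) _ (end_diff \o submod_val (hom_mx N.+1 k))).
by move=> f; apply: hom_mx_end_diff; exact: submod_valP.
Qed.

Definition end_d k := sval (end_obj_diff k).

Lemma end_dE k f : submod_val _ (end_d k f) = end_diff (submod_val _ f).
Proof. exact: (svalP (end_obj_diff k)). Qed.

Lemma end_dd k f : end_d k.+1 (end_d k f) = 0.
Proof. by apply: submod_val_inj; rewrite !end_dE end_diffK linear0. Qed.

(** Degree [j] of the endomorphism complex sits at index [N + 1 + j], so that this
    is its cohomology in degree [s - N]; index 0 is the zero module. *)
Definition end_homology s : lmodType R := homology (end_d s) (end_d s.+1).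

Lemma end_homology_neg s : (s < N)%N -> zero_module (end_homology s).
Proof.
move=> sN; apply: homology_zero => f df.
have [|||||g [hg dg _]] := @end_diff_solve s 0 (submod_val _ f); rewrite ?add0n //.
- by lia.
- exact: submod_valP.
- by rewrite -end_dE df linear0.
- by lia.
have [x xE] := submod_val_ex hg; exists x; apply: submod_val_inj.
by rewrite end_dE xE.
Qed.

Lemma end_obj_large k : (N.+1 + N < k)%N -> zero_module (end_obj k).
Proof.
move=> kN f; apply: submod_val_inj; rewrite linear0; apply/matrixP => a c.
rewrite mxE; apply: (submod_valP f); have := deg_le a; lia.
Qed.

Lemma end_obj_projection k : {pr : {linear 'M[R]_b -> end_obj k} |
  forall f a c, submod_val _ (pr f) a c =
    if (deg a + N.+1 == deg c + k)%N then f a c else 0}.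
Proof.
apply: cid.
pose p (f : 'M[R]_b) : 'M[R]_b :=
  \matrix_(a, c) (if (deg a + N.+1 == deg c + k)%N then f a c else 0).
have pl : linear p.
  by move=> x f g; apply/matrixP => a c; rewrite !mxE; case: eqP; rewrite ?mulr0 ?addr0.
have [f a c /negbTE ac|pr prE] := @submod_corestr _ _ (hom_mx N.+1 k) _ (mk_linear pl).
  by rewrite mk_linearE mxE ac.
by exists pr => f a c; rewrite prE mk_linearE mxE.
Qed.

Lemma end_obj_projective k : projective_module (end_obj k).
Proof.
have [pr prE] := end_obj_projection k.
pose v := (@vec_mx R b b : {linear 'rV[R]_(b * b) -> 'M[R]_b}).
pose u := (@mxvec R b b : {linear 'M[R]_b -> 'rV[R]_(b * b)}).
apply: (projective_retract (i := u \o submod_val _) (r := pr \o v) (@projective_rV R _)) => x.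
apply: submod_val_inj; apply/matrixP => a c; rewrite /= prE mxvecK.
by case: eqVneq => // /(submod_valP x) ->.
Qed.

(** Evaluation on [F_q] followed by the augmentation identifies the cohomology of
    Hom (F, F) with that of Hom (F, M). *)
Lemma end_homology_Ext q :
  isomorphic (end_homology (N + q)) (Ext_of (gr_resolution G) q M).
Proof.
have [A [fA [-> fAE]]] := Ext_of_homology M (gr_resolution G) q.
pose ev (f : end_obj (N + q).+1) : Hom_module (gr_resolution G q) M :=
  hom_of (aug \o mulmxr (submod_val _ f) \o submod_val (homog deg q)).
have evE f v : val (ev f) v = aug (submod_val (homog deg q) v *m submod_val _ f) by [].
have evl : linear ev.
  move=> a f g; apply: homP => v; rewrite homD homZ !evE.
  rewrite (linearP (submod_val (hom_mx N.+1 (N + q).+1))).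
  by rewrite mulmxDr linearD -scalemxAr linearZ.
have [pr prE] := gr_obj_proj G q.
have rowq a : deg a = q -> exists v : gr_resolution G q, submod_val (homog deg q) v = delta_mx 0 a.
  by move=> <-; apply: submod_val_ex; exact: homog_delta.
apply: (homology_isomorphic (h := mk_linear evl)).
- move=> f df; apply/ext_cocycle => v; rewrite mk_linearE lin_ofE evE.
  by rewrite gr_resolution_diffE -aug_end_diff -end_dE df !linear0.
- move=> f df; rewrite fAE; split=> [[g <-]|cf].
    have dgE v : val (ev (end_d _ g)) v =
      aug (submod_val (homog deg q) v *m D *m submod_val _ g).
      by rewrite evE end_dE aug_end_diff.
    case: q {A fA fAE pr prE rowq f df} @ev evE evl g dgE => [|q] ev evE evl g dgE.
      move=> v; rewrite mk_linearE dgE gr_homog0_diff ?mul0mx ?linear0 //.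
      exact: (submod_valP v).
    exists (aug \o mulmxr (submod_val _ g) \o submod_val (homog deg q)) => v.
    by rewrite mk_linearE dgE /= -gr_resolution_diffE.
  have : exists g0, hom_mx N.+1 (N + q) g0 /\ forall a, deg a = q ->
      aug (row a (submod_val _ f)) = aug (row a D *m g0).
    case: q {A fA fAE pr prE} @ev evE evl f df cf rowq => [|q] ev evE evl f df cf rowq.
      exists 0; split=> [|a a0]; first exact: submodule0.
      have [v vE] := rowq a a0; rewrite mulmx0 linear0 rowE -vE -evE.
      by have := cf v; rewrite mk_linearE.
    have [gam gamE] := cf; have [pr prE] := gr_obj_proj G q.
    have [g0 [hg0 _ g0E]] := lift_rows q (gam \o pr).
    exists g0; split=> [|a aq]; first by rewrite addnS.
    have [v vE] := rowq a aq; rewrite !rowE -vE -evE.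
    rewrite -[val (ev f) v]/(val (mk_linear evl f) v) gamE.
    rewrite g0E; last by apply: gr_homog_diff; exact: (submod_valP v).
    congr (gam _); apply: (@submod_val_inj _ _ (homog deg q)).
    rewrite -[RHS]/(submod_val (homog deg q) (pr _)) prE gr_resolution_diffE homog_part_id //.
    by apply: gr_homog_diff; exact: (submod_valP v).
  move=> [g0 [hg0 g0E]].
  have hd : hom_mx N.+1 (N + q).+1 (submod_val _ f - end_diff g0).
    apply: submoduleB; first exact: submod_valP.
    exact: hom_mx_end_diff.
  have [|||a aq|_ a aq|g [hg dg _]] := @end_diff_solve (N + q) q (submod_val _ f - end_diff g0).
  + by rewrite addnC.
  + exact: hd.
  + by rewrite end_diffB end_diffK subr0 -end_dE df linear0.
  + by apply/rowP => c; rewrite mxE [RHS]mxE; apply: hd; lia.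
  + rewrite linearB linearB /= g0E //; apply/eqP; rewrite subr_eq0; apply/eqP.
    by rewrite [X in _ = aug X]rowE aug_end_diff -rowE.
  have [x xE] := submod_val_ex (submoduleD hg hg0); exists x; apply: submod_val_inj.
  by rewrite end_dE xE end_diffD dg subrK.
- move=> F /ext_cocycle F0.
  have [f0 [hf0 f0r f0E]] := lift_rows q (lin_of F \o pr).
  have f0D v : homog deg q.+1 v -> aug (v *m D *m f0) = 0.
    move=> hv; rewrite f0E; last exact: gr_homog_diff.
    have [x xE] := submod_val_ex hv.
    rewrite -(F0 x) /=; congr (val F _); apply: (@submod_val_inj _ _ (homog deg q)).
    rewrite gr_resolution_diffE xE -[LHS]/(submod_val (homog deg q) (pr _)) prE.
    by rewrite homog_part_id //; exact: gr_homog_diff.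
  have rowd a : (deg a < q.+1)%N -> row a (end_diff f0) = 0.
    move=> aq; rewrite /end_diff linearD /= (row_diff_mul (r := q)) //; last first.
      by move=> e eq; rewrite f0r //; lia.
    rewrite add0r rowE -!mulmxA; set w := f0 *m (D *m E).
    have -> : delta_mx 0 a *m (E *m w) = (-1) ^+ deg a *: row a w :> 'rV_b.
      by rewrite -rowE; apply/rowP => c; rewrite mxE sign_mxM !mxE.
    rewrite /w row_mul; have [ar|ar] := eqVneq (deg a) q; last by rewrite f0r // mul0mx scaler0.
    rewrite mulmxA gr_homog0_diff ?mul0mx ?scaler0 //.
    exact: homog_row hf0 ar.
  have [||||g [hg dg gr]] := @end_diff_solve (N + q).+1 q.+1 (end_diff f0) _ _ _ rowd.
  + by rewrite addSn addnC.
  + exact: hom_mx_end_diff.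
  + exact: end_diffK.
  + move=> _ a aq; rewrite rowE aug_end_diff f0D //.
    by rewrite -aq; exact: homog_delta.
  have [x xE] := submod_val_ex (submoduleB hf0 hg); exists x; split.
    by apply: submod_val_inj; rewrite end_dE xE end_diffB dg subrr linear0.
  rewrite fAE; suff -> : F - mk_linear evl x = 0.
    case: (q) => [|r]; first by [].
    by exists (\0 : {linear _ -> _}).
  apply: homP => v; rewrite homD homN mk_linearE evE xE mulmxBr linearB f0E;
    last exact: (submod_valP v).
  have -> : submod_val (homog deg q) v *m g = 0.
    rewrite mulmx_sum_row big1 // => a _; have [aq|aq] := eqVneq (deg a) q.
      by rewrite gr ?scaler0 // aq.
    by rewrite (submod_valP v) // scale0r.
  rewrite linear0 subr0 hom0; apply/eqP; rewrite subr_eq0; apply/eqP.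
  congr (val F _); apply: (@submod_val_inj _ _ (homog deg q)).
  by rewrite -[RHS]/(submod_val (homog deg q) (pr _)) prE homog_part_id //; exact: (submod_valP v).
Qed.

Lemma mxtrace_delta (A : 'M[R]_b) a c : \tr (A *m delta_mx a c) = A c a.
Proof.
rewrite /mxtrace (bigD1 c) //= big1 => [|e ec].
  rewrite addr0 mxE (bigD1 a) //= big1 => [|e ea]; first by rewrite mxE !eqxx mulr1 addr0.
  by rewrite mxE (negbTE ea) mulr0.
rewrite mxE big1 // => e' _.
by rewrite mxE (negbTE ec) andbF mulr0.
Qed.

(** A cocycle [z] of degree [k > 0] defines by the supertrace a linear form on
    degree [-k] which vanishes on boundaries, hence on cocycles since there is no
    cohomology in negative degrees; if it extends along the differential to degree
    [1 - k], the extension is the supertrace against some [w], and self-duality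
    turns it into a primitive of [z]. *)
Lemma end_diff_dual (I : inj_resolution (R^o : lmodType R)) k z :
    (0 < k)%N -> (k <= N)%N -> ext_vanishes I 0 (coker end_d (N - k).+1) ->
    hom_mx N.+1 (N.+1 + k) z -> end_diff z = 0 ->
  exists y, end_diff y = z.
Proof.
move=> k0 kN vC hz dz; set s := (N - k)%N in vC.
have tl : linear (fun f : end_obj s.+1 => \tr (E *m z *m submod_val _ f) : R^o).
  move=> a f g; rewrite (linearP (submod_val (hom_mx N.+1 s.+1))).
  by rewrite mulmxDr linearD -scalemxAr linearZ.
have [f df|g gE] := ext_vanishes_extend (I := I) (f := mk_linear tl) vC.
  have sN : (s < N)%N by rewrite /s; lia.
  have [h <-] := homology_zero_exact (end_homology_neg sN) df.
  rewrite mk_linearE end_dE supertrace_end_diff end_diff_conj dz.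
  by rewrite mulmx0 mul0mx oppr0 mulmx0 mul0mx mxtrace0 oppr0.
have [pr prE] := end_obj_projection s.+2.
pose w0 : 'M[R]_b := \matrix_(c, a) (g (pr (delta_mx a c)) : R).
have w0E f : g f = \tr (w0 *m submod_val _ f).
  rewrite [submod_val _ f]matrix_sum_delta.
  have {1}-> : f = pr (\sum_a \sum_c submod_val _ f a c *: delta_mx a c).
    rewrite -matrix_sum_delta; apply: submod_val_inj; apply/matrixP => a c.
    by rewrite prE; case: eqVneq => // /(submod_valP f) ->.
  rewrite mulmx_sumr !linear_sum; apply: eq_bigr => a _.
  rewrite mulmx_sumr !linear_sum; apply: eq_bigr => c _.
  by rewrite -scalemxAr !linearZ /= mxtrace_delta mxE.
have hw0 : hom_mx s.+2 N.+1 w0.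
  move=> c a ca; rewrite mxE.
  suff -> : pr (delta_mx a c) = 0 by rewrite linear0.
  apply: submod_val_inj; apply/matrixP => a' c'; rewrite prE linear0 [RHS]mxE mxE.
  case: (a' =P a) => [->|]; last by case: ifP.
  case: (c' =P c) => [->|]; last by case: ifP.
  by case: eqP => // e; move/eqP: ca; lia.
pose w := E *m w0; pose y := E *m w *m E.
have hy : hom_mx N.+1 (N.+1 + k) (end_diff y).
  apply: (@hom_mx_shift s.+2 N.+2); first by rewrite /s; lia.
  apply: hom_mx_end_diff.
  apply: hom_mx_shift (hom_mxM (hom_mxM hom_mx_sign (hom_mxM hom_mx_sign hw0)) hom_mx_sign).
  by lia.
exists (- y); rewrite -[- y]sub0r end_diffB end_diff0 sub0r.
apply/matrixP => c a; have [ca|ca] := eqVneq (deg c + N.+1)%N (deg a + (N.+1 + k))%N; last first.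
  by rewrite mxE hy // hz // oppr0.
have hac : hom_mx N.+1 s.+1 (delta_mx a c).
  move=> a' c' ac'; rewrite mxE; case: (a' =P a) => // aE; case: (c' =P c) => // cE.
  by move/eqP: ac'; rewrite aE cE /s; lia.
have [f fE] := submod_val_ex hac.
have : \tr (w0 *m end_diff (delta_mx a c)) = \tr (E *m z *m delta_mx a c).
  by rewrite -fE -end_dE -w0E gE.
rewrite -[w0]mul1mx -sign_mx_sqr -(mulmxA E E w0) supertrace_end_diff -/y.
rewrite !mxtrace_delta !sign_mxM => /(congr1 (fun x => (-1) ^+ deg c * x)).
by rewrite mulrN !mulrA -expr2 sqrr_sign !mul1r => <-; rewrite [LHS]mxE.
Qed.

End EndomorphismComplex.

(** * The bound on the projective dimension *)

Section Bound.
Variables (R : comNzRingType) (m : {pred R}) (M : lmodType R).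
Hypothesis R_local : local_ring m.
Variable G : graded_resolution m M.
Variable N : nat.
Hypothesis deg_le : forall a : 'I_(gr_rank G), (gr_deg a <= N)%N.

Local Notation D := (gr_diff G).
Local Notation deg := (@gr_deg R m M G).
Local Notation aug := (gr_aug G).

Lemma mulmx_max b (v : 'rV[R]_b) (B : 'M[R]_b) :
  (forall a, v 0 a \in m) -> forall c, (v *m B) 0 c \in m.
Proof.
move=> vm c; rewrite mxE; apply: (@submodule_sum _ _ (max_submod R_local)) => a _.
by rewrite mulrC; apply: (maxZ R_local).
Qed.

Lemma boundary_max (w : 'rV_(gr_rank G)) c : (w *m D) 0 c \in m.
Proof.
rewrite mxE; apply: (@submodule_sum _ _ (max_submod R_local)) => a _.
by apply: (maxZ R_local); exact: gr_minimal.
Qed.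

(* A basis vector of least degree is not a boundary, by minimality, but it would be
   a cycle if this degree were positive. *)
Lemma deg0_ex (a : 'I_(gr_rank G)) : exists c, deg c = 0%N.
Proof.
case: (arg_minnP deg (isT : xpredT a)) => c _ cmin; exists c.
apply: contrapT => /eqP c0.
have cD : (delta_mx 0 c : 'rV_(gr_rank G)) *m D = 0.
  rewrite -rowE; apply/rowP => e; rewrite !mxE gr_diff_deg //.
  by have := cmin e isT; lia.
have [w wE] := gr_exact cD (gr_aug_deg c0).
have /negP[] := max1 R_local; have -> : (1 : R) = (w *m D) 0 c by rewrite -wE mxE !eqxx.
exact: boundary_max.
Qed.

(** A map from the top free module to a basis vector of [F_0] is a cocycle of
    the endomorphism complex.  Were it a boundary, minimality of the differential
    would put a minimal generator of [M] into [m M]. *)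
Lemma top_end_homology (a : 'I_(gr_rank G)) : deg a = N -> (0 < N)%N ->
  exists z, [/\ hom_mx G N.+1 (N.+1 + N) z, end_diff z = 0 & forall y, end_diff y <> z].
Proof.
move=> aN N0; have [c c0] := deg0_ex a; pose z : 'M[R]_(gr_rank G) := delta_mx a c.
have hz : hom_mx G N.+1 (N.+1 + N) z.
  move=> a' c' ac; rewrite mxE; case: (a' =P a) => // aE; case: (c' =P c) => // cE.
  by move/eqP: ac; rewrite aE cE; lia.
exists z; split=> //.
  have hdz := hom_mx_end_diff hz; apply/matrixP => a' c'; rewrite hdz ?mxE //.
  by have := deg_le a'; lia.
move=> y yz; pose u := (delta_mx 0 a : 'rV_(gr_rank G)) *m D *m y.
have um e : u 0 e \in m.
  by apply: mulmx_max; exact: boundary_max.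
have augu : aug (delta_mx 0 c) = aug u.
  have <- : (delta_mx 0 a : 'rV_(gr_rank G)) *m z = delta_mx 0 c by rewrite /z mul_delta_mx.
  by rewrite -yz aug_end_diff.
pose v := (delta_mx 0 c : 'rV_(gr_rank G)) - homog_part deg 0 u.
have hv : homog deg 0 v.
  apply: submoduleB; last exact: homog_partP.
  by have := @homog_delta R _ deg c; rewrite c0; exact.
have [|w wE] := gr_exact (gr_homog0_diff hv).
  by rewrite linearB /= augu aug_homog0 ?subrr //; exact: gr_aug_deg.
have vc : v 0 c \in m by rewrite wE; exact: boundary_max.
have /negP[] := max1 R_local; have -> : (1 : R) = v 0 c - (- 1) * u 0 c.
  have -> : v 0 c = 1 - u 0 c by rewrite /v 3!mxE [X in _ - X]mxE c0 !eqxx.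
  by rewrite mulN1r opprK subrK.
by apply: (maxB R_local) => //; apply: (maxZ R_local).
Qed.

End Bound.

Theorem theorem1p2 (R : comNzRingType) (m : {pred R}) (d : nat)
    (hR : gorenstein_local m) (hd : krull_dim_eq R d)
    (M : lmodType R) (hM : fin_gen M) (hpd : finite_proj_dim M)
    (n : nat) (hn : (1 <= n)%N)
    (hExt : zero_module (Ext n M M))
    (hdepth : forall q : nat, (q + n <= d)%N ->
       depth_ge m (Ext q M M) (d - n - q)%N) :
  proj_dim_le M n.-1.
Proof.
have [R_noeth R_local [r [I Ir]]] := hR; have [k /pd_le_resolution pdM] := hpd.
have [G _] := graded_resolution_ex R_noeth R_local pdM hM.
pose N := \max_a gr_deg (g := G) a.
have deg_le a : (gr_deg (g := G) a <= N)%N by exact: leq_bigmax.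
have [Nn|nN] := leqP N n.-1.
  by apply: (gr_proj_dim (G := G)) => a; apply: leq_trans Nn.
have [a aN] : exists a, gr_deg (g := G) a = N.
  have [b0|b0] := posnP (gr_rank G).
    suff N0 : N = 0%N by rewrite N0 in nN.
    by rewrite /N big1 // => a _; case: a => a alt; have := alt; rewrite {1}b0.
  have [|a aE] := @eq_bigmax _ (gr_deg (g := G)); first by rewrite card_ord.
  by exists a; rewrite /N aE.
have N0 : (0 < N)%N by lia.
have [z [hz dz nz]] := top_end_homology R_local deg_le aN N0.
have HE q : isomorphic (end_homology G N (N + q)) (Ext q M M).
  apply: isomorphic_trans (end_homology_Ext deg_le q) _.
  exact: Ext_of_independent.
(* Ext^(u+1) (Ext^q (M, M), R) vanishes as soon as u + 1 - q > n *)
have vE q u : (q + n <= u)%N -> ext_vanishes I u (end_homology G N (N + q)).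
  move=> qu; have Hfg : fin_gen (end_homology G N (N + q)).
    apply: fin_gen_surj (@homology_class_surj _ _ _ _ _ _) _.
    apply: (fin_gen_inj R_noeth (@cycles_val_inj _ _ _ _)).
    apply: (fin_gen_inj R_noeth (@submod_val_inj _ _ _)).
    have bij : injective (@mxvec R (gr_rank G) (gr_rank G)) by apply: can_inj mxvecK.
    exact: (fin_gen_inj R_noeth bij (fin_gen_rV _ _)).
  have vd := ext_vanishes_dim R_noeth R_local hd Ir.
  have [f [fi fs]] := HE q; have [g [gi gs]] := isomorphic_sym (HE q).
  have [qd|dq] := leqP (q + n) d; last first.
    by apply: vd => //; apply: leq_trans qu; exact: ltnW.
  have [E0|[xs [xsm reg xsd]]] := hdepth q qd.
    by apply: ext_vanishes_zero => x; apply: fi; rewrite linear0 (E0 (f x)).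
  apply: (ext_vanishes_iso gi gs).
  apply: (ext_vanishes_depth R_noeth R_local (d := d) _ _ xsm reg) => //.
    exact: fin_gen_surj fs Hfg.
  by lia.
have [Nn|nN'] := eqVneq N n.
  have Hn : zero_module (end_homology G N (N + N)).
    have ExtN : zero_module (Ext N M M) by rewrite Nn.
    by have [f [fi _]] := HE N; move=> x; apply: fi; rewrite linear0; exact: ExtN.
  have [x xE] := submod_val_ex hz.
  have [|y yx] := homology_zero_exact (b := x) Hn.
    by apply: submod_val_inj; rewrite end_dE xE dz linear0.
  by case: (nz (submod_val _ y)); rewrite -end_dE yx.
have vC : ext_vanishes I 0 (coker (@end_d R m M G N) (N - N).+1).
  apply: (@ext_vanishes_coker _ _ _ _ _ _ _ (N.+1 + N).+1) => [j|j x|j jN|u].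
  - exact: end_obj_projective.
  - exact: end_dd.
  - exact: end_obj_large.
  rewrite add0n subnn add1n.
  have [uN|Nu] := ltnP u.+1 N; first by apply: ext_vanishes_zero; exact: end_homology_neg.
  by rewrite -(subnKC Nu); apply: vE; lia.
have [y yz] := end_diff_dual deg_le N0 (leqnn N) vC hz dz.
by case: (nz y).
Qed.
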